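(* Let $D\ge 3$. Let $f:[0,+\infty)\to\mathbb{R}$ be a $C^1$ function with $f\not\equiv 0$, $f(0)=0$, $f(t)>0$ for $t>0$, satisfying the Keller-Osserman condition $\int^{+\infty}\frac{ds}{\sqrt{F(s)}}<+\infty$. Let $\rho:\mathbb{R}^D\to(0,+\infty)$ be a $C^1$ function satisfying $\lim_{|x|\to+\infty}\int_{\mathbb{R}^D}|x-y|^{2-D}\rho(y)\,dy=0$. Assume in addition that (i) there exist $c\in(0,1)$ and $\alpha>2$ such that $$c|x|^{-\alpha}\le\rho(x)\le\frac1c|x|^{-\alpha}\quad\text{for all }|x|>1;$$ (ii) there exists $M>0$ such that the mapping $u\mapsto f(u)/u$ is nondecreasing in $I=[M,+\infty)$, and there exists $C>0$ such that $$\frac{f(u)}{u}\le\frac{C}{\Phi^2(u)}\quad\text{for all }u\in I,\qquad\text{where}\quad \Phi(u)=\int_u^{+\infty}\frac{dt}{\sqrt{F(t)-F(u)}}.$$ Let $u$ be an unbounded solution of $$\Delta u=\rho(x)f(u),\quad u>0\qquad\text{in }\mathbb{R}^D.$$ Then $\lim_{|x|\to+\infty}u(x)=+\infty$.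
   Context: Here $F(s)=\int_a^s f(t)\,dt$, where $a>0$ is a fixed constant (since $f>0$ on $(0,+\infty)$, any $a>0$ may be used), and $\int^{+\infty}$ means integration over a neighborhood $[s_0,+\infty)$ of $+\infty$ with some $s_0>a$. Solutions are classical ($C^2(\mathbb{R}^D)$). *)

(* Defs.v *)
From HB Require Import structures.
From mathcomp Require Import all_boot all_order all_algebra.
From mathcomp Require Import all_classical all_reals all_analysis.

Set Implicit Arguments.
Unset Strict Implicit.
Unset Printing Implicit Defensive.

Import Order.TTheory GRing.Theory Num.Theory.
Import numFieldNormedType.Exports.

Local Open Scope classical_set_scope.
Local Open Scope ring_scope.

(* Lebesgue measure on R^n, built on [n.-tuple R] with its product (Borel)
   sigma-algebra: the image of lebesgue_measure \x (Lebesgue measure on R^n)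
   under (t, y) |-> t :: y is Lebesgue measure on R^n.+1. *)
Section lebesgue_tuple.
Local Open Scope ereal_scope.
Context {R : realType}.

Definition tuple_cons n (p : R * n.-tuple R) : n.+1.-tuple R :=
  [tuple of p.1 :: p.2].

Lemma measurable_tuple_cons n :
  measurable_fun [set: R * n.-tuple R] (@tuple_cons n).
Proof. exact: measurable_cons. Qed.

Section step.
Variables (n : nat) (m : {sigma_finite_measure set (n.-tuple R) -> \bar R}).

Definition lebesgue_step : set (n.+1.-tuple R) -> \bar R :=
  pushforward (@lebesgue_measure R \x m) (@tuple_cons n).

Let mcons := @measurable_tuple_cons n.

Let step0 : lebesgue_step set0 = 0.
Proof. exact: measure0. Qed.

Let step_ge0 A : 0 <= lebesgue_step A.
Proof. exact: measure_ge0. Qed.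

Let step_sigma_additive : semi_sigma_additive lebesgue_step.
Proof. exact: measure_semi_sigma_additive. Qed.

HB.instance Definition _ := isMeasure.Build _ _ _ lebesgue_step
  step0 step_ge0 step_sigma_additive.

Lemma lebesgue_stepE (A : set R) (B : set (n.-tuple R)) :
  measurable A -> measurable B ->
  lebesgue_step [set y | A (thead y) /\ B [tuple of behead y]] =
  @lebesgue_measure R A * m B.
Proof.
move=> mA mB; rewrite -(product_measure1E (@lebesgue_measure R) m mA mB) /=.
rewrite /lebesgue_step /pushforward; congr (_ _).
apply/seteqP; split=> -[t y] /=; rewrite theadE.
  by move=> [At]; rewrite (_ : [tuple of _] = y)//; exact/val_inj.
by move=> [At By]; split=> //; rewrite (_ : [tuple of _] = y)//; exact/val_inj.
Qed.

Let step_sigma_finite : sigma_finite setT lebesgue_step.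
Proof.
have /sigma_finiteP[F [TF ndF Foo]] := sigma_finiteT (@lebesgue_measure R).
have /sigma_finiteP[G [TG ndG Goo]] := sigma_finiteT m.
exists (fun k => [set y | F k (thead y) /\ G k [tuple of behead y]]).
  apply/seteqP; split=> // y _.
  have [i _ Fi] : (\bigcup_k F k) (thead y) by rewrite -TF.
  have [j _ Gj] : (\bigcup_k G k) [tuple of behead y] by rewrite -TG.
  exists (maxn i j) => //; split.
    by move: Fi; exact/subsetPset/ndF/leq_maxl.
  by move: Gj; exact/subsetPset/ndG/leq_maxr.
move=> k; have [mF Fk] := Foo k; have [mG Gk] := Goo k; split; last first.
  by rewrite lebesgue_stepE// lte_mul_pinfty// ge0_fin_numE.
apply: measurableI.
  by rewrite -[X in measurable X]setTI; exact: measurable_tnth.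
by rewrite -[X in measurable X]setTI; exact: measurable_behead.
Qed.

HB.instance Definition _ := Measure_isSigmaFinite.Build _ _ _ lebesgue_step
  step_sigma_finite.

End step.

Fixpoint lebesgue_tuple n : {sigma_finite_measure set (n.-tuple R) -> \bar R} :=
  match n with
  | 0 => dirac [tuple]
  | n'.+1 => lebesgue_step (lebesgue_tuple n')
  end.

Lemma lebesgue_tuple_box n (B : 'I_n -> set R) :
  (forall i, measurable (B i)) ->
  lebesgue_tuple n [set y | forall i, B i (tnth y i)] =
  \prod_(i < n) @lebesgue_measure R (B i).
Proof.
elim: n B => [|n IHn] B mB.
  rewrite big_ord0 /= diracE mem_set//.
  by case.
rewrite big_ord_recl -IHn// -lebesgue_stepE//; last first.
  rewrite (_ : mkset _ = \bigcap_i ((@tnth n R)^~ i @^-1` B (lift ord0 i))).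
    apply: fin_bigcap_measurable => // i _.
    by rewrite -[X in measurable X]setTI; exact: measurable_tnth.
  by apply/seteqP; split=> y //= By i; [move=> _ |]; exact: By.
have tnthE (y : n.+1.-tuple R) j :
    tnth [tuple of behead y] j = tnth y (lift ord0 j).
  by rewrite tnth_behead; congr tnth; apply/val_inj; rewrite /= inordK ?ltnS.
congr (_ _); apply/seteqP; split=> y /=.
  by move=> By; split=> [|i]; [exact: By|rewrite tnthE].
move=> [B0 By] i; case: (unliftP ord0 i) => [j ->|-> //].
by rewrite -tnthE.
Qed.

End lebesgue_tuple.

Section Rn.
Context {R : realType} {D : nat}.
Implicit Types (x : 'rV[R]_D) (g : 'rV[R]_D -> R).

(* The library norm on ['rV[R]_D] is the sup norm, hence a separate
   Euclidean norm. *)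
Definition enorm x : R := Num.sqrt (\sum_(i < D) x 0 i ^+ 2).

(* The filter |x| -> +oo on R^D. *)
Definition at_infinity : set_system 'rV[R]_D :=
  filter_from setT (fun r : R => [set x | r < enorm x]).

Lemma at_infinity_filter : Filter at_infinity.
Proof.
apply: filter_from_filter; first by exists 0.
move=> r s _ _; exists (Num.max r s) => // x /=.
by rewrite gt_max => /andP[].
Qed.

Definition partial (i : 'I_D) g : 'rV[R]_D -> R :=
  fun x => 'D_(delta_mx 0 i) g x.

Definition C1 g : Prop :=
  (forall x, differentiable g x) /\ forall i, continuous (partial i g).

Definition C2 g : Prop := C1 g /\ forall i, C1 (partial i g).

Definition laplacian g x : R := \sum_(i < D) partial i (partial i g) x.

Definition row_of_tuple (y : D.-tuple R) : 'rV[R]_D := \row_i tnth y i.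

(* x |-> \int_{R^D} |x - y|^(2-D) g(y) dy, for D >= 2; the integrand takes the
   value 0 or g(x) on the null set {y = x}. *)
Definition newton_potential g x : \bar R :=
  (\int[lebesgue_tuple D]_y
     (enorm (x - row_of_tuple y) ^- (D - 2) * g (row_of_tuple y))%:E)%E.

End Rn.

#[global] Existing Instance at_infinity_filter.

Section half_line.
Context {R : realType}.
Implicit Types f : R -> R.

(* f restricted to [0, +oo[ is C^1 there, with a one-sided derivative at 0;
   values of f at negative arguments are irrelevant. *)
Definition C1_half_line f : Prop :=
  exists2 f' : R -> R, {within `[0, +oo[, continuous f'} &
    forall t, 0 <= t ->
      (f s - f t) / (s - t) @[s --> within [set s | 0 <= s] t^'] --> f' t.

(* Oriented integral \int_a^s f. *)
Definition primitive (a : R) f (s : R) : R :=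
  if a <= s then \int[lebesgue_measure]_(t in `[a, s]) f t
  else - \int[lebesgue_measure]_(t in `[s, a]) f t.

Definition keller_osserman (a : R) f : Prop :=
  exists2 s0, a < s0 &
    (\int[lebesgue_measure]_(s in `[s0, +oo[)
       ((Num.sqrt (primitive a f s))^-1)%:E < +oo)%E.

Definition Phi (a : R) f (u : R) : R :=
  \int[lebesgue_measure]_(t in `]u, +oo[)
    (Num.sqrt (primitive a f t - primitive a f u))^-1.

End half_line.

(* Main.v *)
Require Import Defs.
From HB Require Import structures.
From mathcomp Require Import all_boot all_order all_algebra.
From mathcomp Require Import all_classical all_reals all_analysis.
From mathcomp Require Import ring lra.
Import Order.TTheory GRing.Theory Num.Theory.
Import numFieldNormedType.Exports.
Local Open Scope classical_set_scope.
Local Open Scope ring_scope.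

(** Two estimates drive the growth of [u] at infinity: a universal upper bound
    of Keller-Osserman type, and a Harnack inequality with the same constant on
    all large spheres.

    Upper bound. Fix [x] with [|x|] large. On the ball of radius [|x|/2] around
    [x], the decay assumption bounds [rho] below by a constant multiple of
    [|x|^(-alpha)], so [u] is a subsolution of [Delta w = b f(w)] there, with
    [b] of that order. Comparison with the profile that solves the
    one-dimensional problem and blows up on the boundary of the ball gives
    [b |x|^2 <= const * Phi(v)^2] whenever [M <= v < u(x)]
    ([keller_osserman_bound]). Combined with [f(v)/v <= C / Phi(v)^2] it yields
    [rho(x) f(u(x)) <= K |x|^(-2) u(x)]; where [u(x)] is below [M] the same
    bound holds because [f(t)/t] is bounded near [0]
    ([scale_invariant_bound]). Thus [0 <= Delta u <= K |x|^(-2) u] near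
    infinity, an inequality that is invariant under dilations.

    Harnack. Let [w(z) = (1 - |z|^2)_+ ^2] and [I(t)] be the integral of
    [w(z) u(x + t z)]. Integration by parts gives
    [I'(t) = (t/6) * integral of (1 - |z|^2)_+^3 Delta u(x + t z)]. Since
    [(1 - |z|^2)_+^3 <= w], the bounds [0 <= Delta u <= k u] turn into
    [0 <= I' <= k t I]: weighted averages of [u] over balls are monotone in the
    radius and, by Gronwall, comparable with the value at the centre. Averages
    over nearby balls are compared by the same method, moving the centre while
    the radius grows. The result is [u(y) <= H u(x)] for [|x - y| <= |x|/16],
    with [H] independent of [x] ([harnack], [local_harnack]); a chain of a fixed
    number of points then joins any two points of a large sphere
    ([harnack_sphere]).

    Conclusion. Since [Delta u > 0], the maximum of [u] over a ball is attained
    on its boundary sphere, and it tends to infinity with the radius because [u]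
    is unbounded. By Harnack the minimum over the sphere tends to infinity too.

    Averages only enter through linearity, positivity and integration by parts,
    so they are taken with respect to a functional [L] built from means over
    finer and finer grids of the cube [-1, 1]^D (the unit ball of the sup norm),
    passing to the limit along an ultrafilter ([cube_mean_exists]). *)

(** * Uniform continuity, and derivatives along lines *)

Section uniform.
Context {R : realType}.

(** Compactness of [K] makes the continuity of [F] in its first variable uniform
    in the second: this passes limits under the mean over the cube. *)
Lemma compact_uniform (T U : topologicalType) (K : set U) (F : T * U -> R) t0 e :
  compact K -> continuous F -> 0 < e ->
  \forall t \near t0, forall z, K z -> `|F (t, z) - F (t0, z)| <= e.
Proof.
move=> /compact_near_coveringP Kc Fc e0.
apply: (Kc T (nbhs t0) (fun t z => `|F (t, z) - F (t0, z)| <= e)) => z Kz.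
have e20 : 0 < e / 2 by rewrite divr_gt0.
have /cvgrPdist_lt /(_ _ e20) [[A B] /= [At Bz] AB] := Fc (t0, z).
exists (B, A) => //= -[z' t] [/= Bz' At'].
have h1 : `|F (t0, z) - F (t, z')| < e / 2 by exact: AB.
have h2 : `|F (t0, z) - F (t0, z')| < e / 2.
  by apply: AB; split => //=; exact: nbhs_singleton.
rewrite distrC (le_trans (ler_distD (F (t0, z)) _ _))//.
by rewrite distrC in h2; lra.
Qed.

Lemma is_derive_line (n : nat) (g : 'rV[R]_n -> R) (z v : 'rV[R]_n) (s d : R) :
  is_derive (z + s *: v) v g d ->
  is_derive s 1 (fun s => g (z + s *: v)) d.
Proof.
move=> [gd gE].
have e : (fun h : R => h^-1 *: (g (z + (h *: 1 + s) *: v) - g (z + s *: v)))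
       = (fun h : R => h^-1 *: (g (h *: v + (z + s *: v)) - g (z + s *: v))).
  apply/funext => h; congr (_ *: (g _ - _)).
  by rewrite scalerDl scaler1 addrCA.
split; first by rewrite /derivable /= e.
by rewrite /derive /= e.
Qed.

Lemma cube_compact n : compact [set z : 'rV[R]_n | `|z| <= 1].
Proof.
apply: bounded_closed_compact.
  exists 1; split; first by rewrite num_real.
  by move=> x x1 y /= /le_trans; apply; exact: ltW.
apply: (@closed_comp _ _ (fun z : 'rV[R]_n => `|z|) [set x | x <= 1]).
  by move=> z _; exact: norm_continuous.
exact: closed_le.
Qed.

Lemma rV_coord_le n (z : 'rV[R]_n) i : `|z 0 i| <= `|z|.
Proof.
rewrite [leRHS]/Num.norm /= mx_normrE.
exact: (le_bigmax _ (fun k : 'I_1 * 'I_n => `|z k.1 k.2|) (0, i)).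
Qed.

Lemma rV_norm_le n (z : 'rV[R]_n) c : 0 <= c -> (forall i, `|z 0 i| <= c) -> `|z| <= c.
Proof.
move=> c0 h; rewrite [leLHS]/Num.norm /= mx_normrE; apply: bigmax_le => // -[i j] _ /=.
by rewrite ord1.
Qed.
End uniform.

(** * Means over grids *)

Section grid.
Context {R : realType} {D : nat}.
Implicit Types (g h : 'rV[R]_D -> R) (z : 'rV[R]_D).

Definition grid_point {m} (k : {ffun 'I_D -> 'I_m.+1}) : 'rV[R]_D :=
  \row_i ((k i)%:R * (2 / m.+1%:R) - 1).

Definition grid_mean m g : R :=
  (\sum_k g (grid_point (m := m) k)) / m.+1%:R ^+ D.

Lemma grid_point_cube m (k : {ffun 'I_D -> 'I_m.+1}) : `|grid_point k| <= 1.
Proof.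
apply: rV_norm_le => // i; rewrite mxE ler_norml.
have m0 : 0 < m.+1%:R :> R by [].
have : (k i)%:R <= m.+1%:R :> R by rewrite ler_nat ltnW.
rewrite -(@ler_pM2r _ (2 / m.+1%:R)) ?divr_gt0//.
rewrite (_ : m.+1%:R * _ = 2); last by rewrite mulrCA divff ?gt_eqF// mulr1.
have : 0 <= (k i)%:R * (2 / m.+1%:R) :> R by rewrite mulr_ge0// divr_ge0.
by set t := (k i)%:R * _ => h1 h2; apply/andP; split; lra.
Qed.

(** Moving the grid by one step in direction [i] is a cyclic permutation of the
    grid, up to the points leaving through one face and entering through the
    opposite one, where [g] vanishes: a discrete form of the fact that a
    derivative has zero integral. *)
Lemma grid_shift m g i : (forall z, `|z 0 i| = 1 -> g z = 0) ->
  \sum_k g (grid_point (m := m) k + (2 / m.+1%:R) *: delta_mx 0 i) =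
  \sum_k g (grid_point (m := m) k).
Proof.
move=> g0.
pose S (k : {ffun 'I_D -> 'I_m.+1}) : {ffun 'I_D -> 'I_m.+1} :=
  [ffun j => if j == i then ordS (k j) else k j].
pose T (k : {ffun 'I_D -> 'I_m.+1}) : {ffun 'I_D -> 'I_m.+1} :=
  [ffun j => if j == i then ord_pred (k j) else k j].
have ST : cancel S T.
  by move=> k; apply/ffunP => j; rewrite /S /T !ffunE; case: eqP => // _; exact: ordSK.
have TS : cancel T S.
  by move=> k; apply/ffunP => j; rewrite /S /T !ffunE; case: eqP => // _; exact: ord_predK.
rewrite [RHS](reindex S) /=; last by exists T => k _.
apply: eq_bigr => k _.
have [km|km] := ltnP (k i).+1 m.+1.
  (* the shifted point is again a grid point unless the index wraps around *)
  congr g; apply/rowP => j; rewrite !mxE eqxx /= ffunE.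
  case: eqVneq => [->|_] /=; last by rewrite mulr0 addr0.
  rewrite modn_small; last exact: km.
  by rewrite mulr1 -[X in _ = X * _ - 1]natr1; ring.
have ki : (k i).+1 = m.+1 by apply/eqP; rewrite eqn_leq km andbT.
rewrite !g0//.
  rewrite mxE ffunE eqxx /= ki modnn mul0r sub0r normrN normr1//.
rewrite !mxE !eqxx /= mulr1 addrAC -[X in _ + X - _]mul1r -mulrDl.
rewrite natr1 ki mulrCA divff ?gt_eqF// mulr1.
by rewrite (_ : 2 - 1 = 1 :> R) ?normr1//; lra.
Qed.

Lemma grid_meanD m g h :
  grid_mean m (fun z => g z + h z) = grid_mean m g + grid_mean m h.
Proof. by rewrite /grid_mean big_split mulrDl. Qed.

Lemma grid_meanZ m c g : grid_mean m (fun z => c * g z) = c * grid_mean m g.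
Proof. by rewrite /grid_mean -mulr_sumr mulrA. Qed.

Lemma grid_mean_cst m c : grid_mean m (fun=> c) = c.
Proof.
rewrite /grid_mean sumr_const card_ffun !card_ord -[X in X / _]mulr_natr natrX.
by rewrite mulfK// expf_neq0.
Qed.

Lemma grid_mean_le m g h : (forall z, `|z| <= 1 -> g z <= h z) ->
  grid_mean m g <= grid_mean m h.
Proof.
move=> gh; rewrite ler_wpM2r ?invr_ge0 ?exprn_ge0//.
by apply: ler_sum => k _; exact/gh/grid_point_cube.
Qed.

Lemma grid_mean_norm m g c : (forall z, `|z| <= 1 -> `|g z| <= c) ->
  `|grid_mean m g| <= c.
Proof.
move=> gc; rewrite ler_norml -{1}(grid_mean_cst m (- c)) -{2}(grid_mean_cst m c).
by apply/andP; split; apply: grid_mean_le => z /gc; rewrite ler_norml => /andP[].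
Qed.

(** Of the [2 s (n+1)] abscissas in one direction, exactly [n+1] lie in
    [[0, 1/s[], so the grid points with all coordinates there form the
    proportion [(2 s)^(-D)] of the grid, whatever [n]. *)
Lemma grid_mean_ge m s n g c : m.+1 = (2 * s * n.+1)%N ->
  0 <= c -> (forall z, 0 <= g z) ->
  (forall z, (forall i, 0 <= z 0 i <= s%:R^-1) -> c <= g z) ->
  c / (2 * s)%:R ^+ D <= grid_mean m g.
Proof.
move=> mE c0 g0 gc.
have s0 : (0 < s)%N by case: s mE {gc}.
have mER : m.+1%:R = (2 * s)%:R * n.+1%:R :> R by rewrite mE natrM.
rewrite /grid_mean mER exprMn invfM mulrA ler_pdivlMr ?exprn_gt0// mulrAC.
rewrite ler_wpM2r ?invr_ge0 ?exprn_ge0//.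
pose a (j : 'I_m.+1) : R := ((s * n.+1 <= j) && (j < s * n.+1 + n.+1))%N%:R.
have aS : \sum_j a j = n.+1%:R.
  rewrite /a -natr_sum; congr (_%:R).
  rewrite -(big_mkord xpredT (fun j => ((s * n.+1 <= j) && (j < s * n.+1 + n.+1))%N : nat)).
  rewrite mE.
  have h1 : (s * n.+1 <= 2 * s * n.+1)%N by rewrite leq_mul2r leq_pmull ?orbT.
  have h2 : (s * n.+1 + n.+1 <= 2 * s * n.+1)%N.
    by rewrite -mulSnr leq_mul2r mul2n -addnn -(add1n s) leq_add2r s0 orbT.
  rewrite (@big_cat_nat _ _ _ (s * n.+1))//= big_nat_cond big1 ?add0n; last first.
    by move=> j; rewrite andbT => /andP[_]; rewrite ltnNge => /negbTE ->.
  rewrite (@big_cat_nat _ _ _ (s * n.+1 + n.+1))//= ?leq_addr//.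
  rewrite [X in (_ + X)%N]big_nat_cond [X in (_ + X)%N]big1 ?addn0; last first.
    by move=> j; rewrite andbT => /andP[]; rewrite leqNgt => /negbTE ->; rewrite andbF.
  rewrite big_nat_cond (eq_bigr (fun=> 1%N)); last by move=> j; rewrite andbT => ->.
  by rewrite -big_nat_cond sum_nat_const_nat addKn muln1.
have -> : n.+1%:R ^+ D = \sum_(k : {ffun 'I_D -> 'I_m.+1}) \prod_i a (k i).
  by rewrite -(bigA_distr_bigA (fun=> a)) /= aS prodr_const card_ord.
rewrite mulr_sumr; apply: ler_sum => k _.
have [/forallP ak|/forallPn[i /negbTE ai]] :=
    boolP [forall i, (s * n.+1 <= k i) && (k i < s * n.+1 + n.+1)]%N.
  rewrite big1 ?mulr1; last by move=> i _; rewrite /a ak.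
  apply: gc => i; rewrite mxE.
  have /andP[k1 k2] := ak i.
  have s0' : 0 < s%:R :> R by rewrite ltr0n.
  have sn0 : 0 < (s%:R * n.+1%:R) :> R by rewrite mulr_gt0.
  rewrite mER natrM.
  rewrite (_ : _ * _ = (k i)%:R / (s%:R * n.+1%:R)); last first.
    by field; rewrite ?pnatr_eq0 -?lt0n ?s0 ?nat1r ?pnatr_eq0.
  rewrite subr_ge0 lerBlDr ler_pdivlMr// ler_pdivrMr// mul1r mulrDl.
  rewrite mulKf ?gt_eqF// mul1r -natrM -natrD !ler_nat k1.
  by rewrite addnC ltnW.
by rewrite (bigD1 i)//= /a ai mul0r mulr0.
Qed.
End grid.

(** * A mean value functional on the cube *)

Section cube_mean.
Context {R : realType}.

(** The properties of the normalized Lebesgue integral over the cube that the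
    Harnack inequality uses. [cube_mean_gt0] prevents the mean of the weight
    below from vanishing; [cube_mean_partial] is integration by parts. *)
Record cube_mean {D} (L : ('rV[R]_D -> R) -> R) : Prop := CubeMean {
  cube_meanD : forall g h : 'rV[R]_D -> R, continuous g -> continuous h ->
    L (fun z => g z + h z) = L g + L h;
  cube_meanZ : forall c (g : 'rV[R]_D -> R), continuous g -> L (fun z => c * g z) = c * L g;
  cube_mean1 : L (fun=> 1) = 1;
  cube_mean_le : forall g h : 'rV[R]_D -> R, continuous g -> continuous h ->
    (forall z : 'rV[R]_D, `|z| <= 1 -> g z <= h z) -> L g <= L h;
  cube_mean_gt0 : forall (g : 'rV[R]_D -> R) c, continuous g -> (forall z : 'rV[R]_D, 0
      <= g z) -> 0 < c ->
    (forall z : 'rV[R]_D, `|z| <= (2 * D.+1)%:R^-1 -> c <= g z) -> 0 < L g;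
  cube_mean_partial : forall (i : 'I_D) (g dg : 'rV[R]_D -> R), continuous g ->
      continuous dg ->
    (forall z : 'rV[R]_D, is_derive z (delta_mx 0 i) g (dg z)) ->
    (forall z : 'rV[R]_D, `|z 0 i| = 1 -> g z = 0) -> L dg = 0 }.

Lemma continuous_cube_bounded D (g : 'rV[R]_D -> R) : continuous g ->
  exists B, forall z, `|z| <= 1 -> `|g z| <= B.
Proof.
move=> gc.
have : compact [set g x | x in [set z : 'rV[R]_D | `|z| <= 1]].
  apply: continuous_compact; last exact: cube_compact.
  exact: continuous_subspaceT.
move=> /compact_bounded[B [_ h]]; exists (B + 1) => z z1.
by apply: (h (B + 1)); [rewrite ltrDl|exists z].
Qed.

(** The grid mean of a difference quotient of [g] with the step of the grid is
    zero by [grid_shift], and these quotients converge uniformly to [dg]. *)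
Lemma grid_mean_partial_cvg0 D (m : nat -> nat) (i : 'I_D) (g dg : 'rV[R]_D -> R) :
  (forall n, n <= m n)%N -> continuous dg ->
  (forall z, is_derive z (delta_mx 0 i) g (dg z)) ->
  (forall z : 'rV[R]_D, `|z 0 i| = 1 -> g z = 0) ->
  grid_mean (m n) dg @[n --> \oo] --> 0.
Proof.
move=> mn dgc gdg g0.
have Fc : continuous (fun p : 'rV[R]_D * 'rV[R]_D => dg (p.2 + p.1)).
  move=> p; apply: (@continuous_comp _ _ _ (fun p : 'rV[R]_D * 'rV[R]_D => p.2 + p.1));
      last exact: dgc.
  by apply: cvgD; [exact: cvg_snd|exact: cvg_fst].
apply/cvgr0Pnorm_le => e e0.
have := @compact_uniform R 'rV[R]_D 'rV[R]_D _ _ (0 : 'rV[R]_D) e (@cube_compact R D) Fc e0.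
move=> /nbhs_ballP[d /= d0 dP].
have d20 : 0 < d / 2 by rewrite divr_gt0.
near=> n.
set h : R := 2 / (m n).+1%:R.
have h0 : 0 < h by rewrite divr_gt0.
have hd : h < d.
  have : n.+1%:R^-1 < d / 2 by near: n; exact: (near_infty_natSinv_lt (PosNum d20)).
  have : (m n).+1%:R^-1 <= n.+1%:R^-1 :> R.
    by rewrite lef_pV2 ?posrE// ler_nat ltnS.
  by move=> h1 h2; rewrite /h mulrC -ltr_pdivlMr//; exact: le_lt_trans h1 h2.
pose q z := h^-1 * (g (z + h *: delta_mx 0 i) + -1 * g z).
have q0 : grid_mean (m n) q = 0.
  rewrite /q grid_meanZ grid_meanD grid_meanZ.
  by rewrite {1}/grid_mean grid_shift// mulN1r subrr mulr0.
have -> : dg = (fun z => (dg z - q z) + q z) by apply/funext => z; rewrite subrK.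
rewrite grid_meanD q0 addr0; apply: grid_mean_norm => z z1.
have [c cI cE] : exists2 c, c \in `]0, h[ & q z = dg (z + c *: delta_mx 0 i).
  have gd (s : R) : is_derive s 1 (fun s : R => g (z + s *: delta_mx 0 i))
      (dg (z + s *: delta_mx 0 i)) by exact: is_derive_line.
  have [|c cI] := @MVT R (fun s : R => g (z + s *: delta_mx 0 i)) _ 0 h h0 (fun s (_ :
      s \in `]0, h[) => gd s).
    apply: continuous_subspaceT => s; apply: differentiable_continuous.
    by apply/derivable1_diffP; exact: ex_derive.
  rewrite subr0 scale0r addr0 => gE; exists c => //.
  by rewrite /q mulN1r gE mulrC mulfK// gt_eqF.
rewrite cE distrC; have := dP (c *: delta_mx 0 i) _ z z1.
rewrite /= addr0; apply.
rewrite -ball_normE /= sub0r normrN (le_lt_trans _ hd)//.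
move: cI; rewrite in_itv/= => /andP[c0 ch].
apply: rV_norm_le; first exact: ltW.
move=> j; rewrite !mxE eqxx/=; case: (_ == _); rewrite ?mulr1 ?mulr0 ?normr0 ?ltW//.
by rewrite gtr0_norm.
Unshelve. all: by end_near.
Qed.

(** Grid means of a continuous function are bounded, hence converge along any
    ultrafilter; choosing one finer than the eventuality filter turns the
    asymptotic integration by parts on grids into an exact one. *)
Lemma cube_mean_exists D : exists L, @cube_mean D L.
Proof.
have [U [UU oU]] := ultraFilterLemma (eventually_filter).
pose s := (2 * D.+1)%N.
pose m n := (2 * s * n.+1).-1.
have mE n : (m n).+1 = (2 * s * n.+1)%N by rewrite /m prednK.
pose L (g : 'rV[R]_D -> R) : R := lim (grid_mean (m n) g @[n --> U]).
have Lcvg g : continuous g -> grid_mean (m n) g @[n --> U] --> L g.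
  move=> /continuous_cube_bounded[B gB].
  have : compact `[-B, B]%classic by exact: segment_compact.
  move=> /(_ (grid_mean (m n) g @[n --> U]) _); case.
    by apply: (@filterE _ U) => n /=; rewrite in_itv /= -ler_norml; apply: grid_mean_norm.
  move=> p [_ Up]; rewrite /L.
  have gp : grid_mean (m n) g @[n --> U] --> p.
    move=> A pA; have [//|UA] := in_ultra_setVsetC ((fun n => grid_mean (m n) g) @^-1`
        A) UU.
    by have [x [/= ? ?]] := Up (~` A) A UA pA.
  by rewrite (cvg_lim _ gp).
exists L; split.
- move=> g h gc hc; apply/cvg_lim => //.
  under eq_fun do rewrite grid_meanD.
  by apply: cvgD; exact: Lcvg.
- move=> c g gc; apply/cvg_lim => //.
  under eq_fun do rewrite grid_meanZ.
  by apply: cvgMr; exact: Lcvg.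
- apply/cvg_lim => //; under eq_fun do rewrite grid_mean_cst.
  exact: cvg_cst.
- move=> g h gc hc gh; apply: (ler_cvg_to (Lcvg g gc) (Lcvg h hc)).
  by apply: nearW => n; exact: grid_mean_le.
- move=> g c gc g0 c0 cg.
  apply: (@lt_le_trans _ _ (c / (2 * s)%:R ^+ D)); first by rewrite divr_gt0// exprn_gt0.
  apply: (cvgr_to_ge (Lcvg g gc)); apply: nearW => n.
  apply: (@grid_mean_ge _ _ _ s n) => //; first exact: ltW.
  move=> z zs; apply: cg; apply: rV_norm_le => // i.
  by have /andP[z0 z1] := zs i; rewrite ger0_norm.
- move=> i g dg gc dgc gdg g0; apply/cvg_lim => //.
  have mn n : (n <= m n)%N by rewrite -ltnS mE leq_pmull.
  by move=> A /(grid_mean_partial_cvg0 D m i g dg mn dgc gdg g0); exact: oU.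
Qed.
End cube_mean.

(** * Differential calculus *)

Section calculus.
Context {R : realType}.

Lemma is_derive_cvg (V W : normedModType R) (f : V -> W) (x v : V) (d : W) :
  (fun h : R => h^-1 *: (f (h *: v + x) - f x)) @ 0^' --> d ->
  is_derive x v f d.
Proof.
move=> fd; split; first by apply/cvg_ex; exists d.
exact: cvg_lim.
Qed.

Lemma is_derive_add (V : normedModType R) (f g : V -> R) (x v : V) (a b : R) :
  is_derive x v f a -> is_derive x v g b ->
  is_derive x v (fun z => f z + g z) (a + b).
Proof. by move=> fa gb; exact: is_deriveD. Qed.

Lemma is_derive_mul (V : normedModType R) (f g : V -> R) (x v : V) (a b : R) :
  is_derive x v f a -> is_derive x v g b ->
  is_derive x v (fun z => f z * g z) (a * g x + f x * b).
Proof.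
move=> fa gb; apply: (is_derive_eq (is_deriveM fa gb)).
by rewrite /GRing.scale /= addrC mulrC.
Qed.

Lemma is_derive_bigsum (V : normedModType R) n (f : 'I_n -> V -> R) (x v : V)
    (a : 'I_n -> R) : (forall i, is_derive x v (f i) (a i)) ->
  is_derive x v (fun z => \sum_i f i z) (\sum_i a i).
Proof.
move=> fa; have := is_derive_sum fa; congr is_derive.
by apply/funext => z; rewrite fct_sumE.
Qed.

Lemma is_derive_line0 (n : nat) (g : 'rV[R]_n -> R) (z v : 'rV[R]_n) (d : R) :
  is_derive (0 : R) 1 (fun s => g (z + s *: v)) d -> is_derive z v g d.
Proof.
move=> [gd gE].
have e : (fun h : R => h^-1 *: (g (z + (h *: 1 + 0) *: v) - g (z + 0 *: v)))
       = (fun h : R => h^-1 *: (g (h *: v + z) - g z)).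
  apply/funext => h; congr (_ *: (g _ - g _)); last by rewrite scale0r addr0.
  by rewrite scaler1 addr0 addrC.
by split; rewrite /derivable /derive -e.
Qed.

Lemma is_derive_comp_line (n : nat) (g : 'rV[R]_n -> R) (q : R -> R)
    (z v : 'rV[R]_n) (a b : R) :
  is_derive z v g a -> is_derive (g z) 1 q b ->
  is_derive z v (fun z => q (g z)) (b * a).
Proof.
move=> ga qb; apply: is_derive_line0.
apply: (@is_derive1_comp R q (fun s : R => g (z + s *: v))).
  by rewrite scale0r addr0.
by apply: is_derive_line; rewrite scale0r addr0.
Qed.

(** A quadratic error bound gives the derivative without a case analysis on the
    sign of [s], which matters for positive parts. *)
Lemma is_derive_quadratic (q : R -> R) (s d : R) :
  (forall h, `|q (s + h) - q s - d * h| <= h ^+ 2) -> is_derive s 1 q d.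
Proof.
move=> qd; apply: is_derive_cvg; apply/cvgrPdist_le => e e0.
near=> h.
have h0 : h != 0 by near: h; exact: nbhs_dnbhs_neq.
have he : `|h| <= e.
  near: h; apply: dnbhs0_le => //.
rewrite distrC (le_trans _ he)// -[X in X - d](mulr1) /GRing.scale /= mulr1.
rewrite -(@ler_pM2r _ `|h|) ?normr_gt0// -normrM mulrBl mulrAC mulVf// mul1r mulr1.
by rewrite -expr2 real_normK ?num_real// [h + s]addrC; exact: qd.
Unshelve. all: by end_near.
Qed.

Lemma is_derive_max0_sqr (s : R) :
  is_derive s 1 (fun s => Num.max 0 s ^+ 2) (2 * Num.max 0 s).
Proof.
apply: is_derive_quadratic => h; rewrite ler_norml !maxEle.
by case: ifPn => ?; case: ifPn => ?; apply/andP; split; nra.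
Qed.

Lemma partial_line n (g : 'rV[R]_n -> R) (x v : 'rV[R]_n) :
  differentiable g x -> is_derive x v g (\sum_i v 0 i * partial i g x).
Proof.
move=> gx; split; first exact: diff_derivable.
rewrite deriveE// [X in 'd _ _ X](row_sum_delta v) linear_sum.
by apply: eq_bigr => i _; rewrite linearZ /= /partial deriveE.
Qed.

(** [expR (c t) * g t] is nondecreasing on [[0, T]]. The sign of [c] is free, so
    applying this to [- g] bounds the growth of [g] from above. *)
Lemma gronwall (g dg : R -> R) (c T : R) : 0 <= T ->
  (forall t : R, is_derive t 1 g (dg t)) ->
  (forall t, 0 <= t <= T -> - c * g t <= dg t) ->
  g 0 <= expR (c * T) * g T.
Proof.
move=> T0 gd gc.
pose F t := expR (c * t) * g t.
have Fd (t : R) : is_derive t 1 F (expR (c * t) * c * g t + expR (c * t) * dg t).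
  apply: is_derive_mul.
  apply: (@is_derive1_comp R expR (fun t => c * t)).
  apply: (is_derive_eq (is_deriveZ c (is_derive_id t 1))).
  by rewrite /GRing.scale /= mulr1.
have -> : g 0 = F 0 by rewrite /F mulr0 expR0 mul1r.
apply: (@ger0_derive1_le_cc _ F 0 T) => //; rewrite ?in_itv /= ?lexx ?T0//.
- move=> x; rewrite in_itv/= => /andP[x0 xT].
  rewrite derive1E; have [_ ->] := Fd x.
  rewrite -mulrA -mulrDr mulr_ge0 ?expR_ge0// -lerBlDl sub0r -mulNr.
  by apply: gc; rewrite !ltW.
- apply: continuous_subspaceT => s; apply: differentiable_continuous.
  by apply/derivable1_diffP; have [h _] := Fd s; exact: h.
Qed.
End calculus.

(** * A compactly supported weight on the unit ball *)

Section harnack.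
Context {R : realType} {D : nat}.
Implicit Types (x y z d : 'rV[R]_D) (u g : 'rV[R]_D -> R).

Definition sqn z : R := \sum_i z 0 i ^+ 2.

(** The second power is C^1 and the third one C^2 across the unit sphere, and
    [grad (ball_weight^3) = - 6 z ball_weight^2] links the two averages in
    [radial_by_parts]. *)
Definition ball_weight z : R := Num.max 0 (1 - sqn z).

Lemma sqn_ge0 z : 0 <= sqn z.
Proof. by apply: sumr_ge0 => i _; exact: sqr_ge0. Qed.

Lemma ball_weight_ge0 z : 0 <= ball_weight z.
Proof. by rewrite /ball_weight le_max lexx. Qed.

Lemma ball_weight_le1 z : ball_weight z <= 1.
Proof. by rewrite /ball_weight ge_max ler01 lerBlDr lerDl sqn_ge0. Qed.

Lemma continuous_sum (T : topologicalType) n (f : 'I_n -> T -> R) :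
  (forall i, continuous (f i)) -> continuous (fun t => \sum_i f i t).
Proof. by move=> fc t; apply: cvg_big => [|i _]; [exact: add_continuous|exact: fc]. Qed.

Lemma continuous_mul (T : topologicalType) (f g : T -> R) :
  continuous f -> continuous g -> continuous (fun t => f t * g t).
Proof. by move=> fc gc t; apply: cvgM; [exact: fc|exact: gc]. Qed.

Lemma continuous_add (T : topologicalType) (V : normedModType R) (f g : T -> V) :
  continuous f -> continuous g -> continuous (fun t => f t + g t).
Proof. by move=> fc gc t; apply: cvgD; [exact: fc|exact: gc]. Qed.

Lemma continuous_scale (T : topologicalType) (V : normedModType R) (s : T -> R)
    (f : T -> V) :
  continuous s -> continuous f -> continuous (fun t => s t *: f t).
Proof. by move=> sc fc t; apply: cvgZ; [exact: sc|exact: fc]. Qed.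

Lemma continuous_cst (T U : topologicalType) (c : U) : continuous (fun _ : T => c).
Proof. by move=> t; exact: cvg_cst. Qed.

Lemma continuous_compose (T U V : topologicalType) (f : T -> U) (g : U -> V) :
  continuous f -> continuous g -> continuous (fun t => g (f t)).
Proof. by move=> fc gc t; apply: continuous_comp; [exact: fc|exact: gc]. Qed.

Lemma continuous_pow (T : topologicalType) (f : T -> R) n :
  continuous f -> continuous (fun t => f t ^+ n).
Proof.
move=> fc; elim: n => [|n IH]; first exact: continuous_cst.
by under eq_fun do rewrite exprS; exact: continuous_mul.
Qed.

Lemma continuous_coord i : continuous (fun z => z 0 i).
Proof. exact: coord_continuous. Qed.

Lemma continuous_sqn : continuous sqn.
Proof.
by apply: continuous_sum => i; apply: continuous_pow; exact: continuous_coord.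
Qed.

Lemma continuous_ball_weight : continuous ball_weight.
Proof.
have c : continuous (fun z => 1 - sqn z).
  move=> z; apply: (@cvgB R R _ (nbhs z) _ (fun=> 1) sqn); first exact: cvg_cst.
  exact: continuous_sqn.
move=> z; apply: (@continuous_max R _ (fun _ => 0) (fun z => 1 - sqn z)).
  exact: cst_continuous.
exact: c.
Qed.

Lemma is_derive_coord z i j :
  is_derive z (delta_mx 0 i) (fun z => z 0 j) ((j == i)%:R).
Proof.
apply: is_derive_cvg.
have E : {near 0^', (fun=> (j == i)%:R : R) =1
   (fun h : R => h^-1 *: ((h *: delta_mx 0 i + z) 0 j - z 0 j))}.
  near=> h; have h0 : h != 0 by near: h; exact: nbhs_dnbhs_neq.
  by rewrite !mxE addrK eqxx /= /GRing.scale /= mulrA mulVf// mul1r.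
by apply: cvg_trans (near_eq_cvg E) _; exact: cvg_cst.
Unshelve. all: by end_near.
Qed.

Lemma is_derive_sqn z i : is_derive z (delta_mx 0 i) sqn (2 * z 0 i).
Proof.
have h j : is_derive z (delta_mx 0 i) (fun z => z 0 j ^+ 2)
    ((j == i)%:R * z 0 j + z 0 j * (j == i)%:R).
  apply: (is_derive_mul _ (fun z => z 0 j) (fun z => z 0 j)); exact: is_derive_coord.
apply: (is_derive_eq (is_derive_bigsum _ _ _ _ _ _ h)).
rewrite (bigD1 i)//= eqxx big1 ?addr0; first by rewrite mul1r mulr1 -mulr2n mulr_natl.
by move=> j /negbTE ->; rewrite mul0r mulr0 addr0.
Qed.

Lemma is_derive_1Bsqn z i :
  is_derive z (delta_mx 0 i) (fun z => 1 - sqn z) (0 - 2 * z 0 i).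
Proof.
apply: (is_derive_add _ (fun=> 1) (fun z => - sqn z)).
exact: (is_deriveN (is_derive_sqn z i)).
Qed.

Lemma is_derive_ball_weight2 z i :
  is_derive z (delta_mx 0 i) (fun z => ball_weight z ^+ 2) (- 4 * ball_weight z * z 0 i).
Proof.
have h := is_derive_1Bsqn z i.
apply: (is_derive_eq (is_derive_comp_line _ _ (fun s => Num.max 0 s ^+ 2)
  _ _ _ _ h (is_derive_max0_sqr _))).
rewrite -/(ball_weight z); ring.
Qed.

Lemma is_derive_ball_weight3 z i :
  is_derive z (delta_mx 0 i) (fun z => ball_weight z ^+ 3) (- 6 * ball_weight z ^+ 2 *
      z 0 i).
Proof.
have E z' : ball_weight z' ^+ 3 = ball_weight z' ^+ 2 * (1 - sqn z').
  rewrite exprSr /ball_weight maxEle; case: ifP => // _.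
  by rewrite expr0n /= !mul0r.
under eq_fun do rewrite E.
have h := is_derive_1Bsqn z i.
apply: (is_derive_eq (is_derive_mul _ (fun z => ball_weight z ^+ 2) (fun z => 1 - sqn z)
  _ _ _ _ (is_derive_ball_weight2 z i) h)).
have E2 : ball_weight z * (1 - sqn z) = ball_weight z ^+ 2.
  by rewrite /ball_weight maxEle; case: ifP => _; rewrite ?mul0r ?expr0n.
rewrite (_ : - 4 * ball_weight z * z 0 i * (1 - sqn z) = - 4 * z 0 i * (ball_weight z *
    (1 - sqn z))); last by ring.
by rewrite E2; ring.
Qed.
End harnack.

(** * Weighted averages over moving balls *)

Section averages.
Context {R : realType} {D : nat}.
Implicit Types (x y z d c : 'rV[R]_D) (u : 'rV[R]_D -> R).
Variable L : ('rV[R]_D -> R) -> R.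
Hypothesis HL : cube_mean L.

Lemma cube_mean_sum n (g : 'I_n -> 'rV[R]_D -> R) :
  (forall i, continuous (g i)) ->
  L (fun z => \sum_i g i z) = \sum_i L (g i).
Proof.
elim: n g => [|n IH] g gc.
  rewrite big_ord0; have -> : (fun z => \sum_(i < 0) g i z) = (fun z => 0 * 1).
    by apply/funext => z; rewrite big_ord0 mul0r.
  by rewrite (cube_meanZ _ HL 0 (fun=> 1)) ?mul0r//; exact: continuous_cst.
under eq_fun do rewrite big_ord_recl.
rewrite (cube_meanD _ HL); first by rewrite big_ord_recl IH.
- exact: gc.
- by apply: continuous_sum.
Qed.

Lemma cube_mean_norm (g : 'rV[R]_D -> R) e : continuous g ->
  (forall z, `|z| <= 1 -> `|g z| <= e) -> `|L g| <= e.
Proof.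
move=> gc ge.
have Lc a : L (fun=> a) = a.
  have -> : (fun=> a) = (fun _ : 'rV[R]_D => a * 1) by apply/funext => z; rewrite mulr1.
  by rewrite (cube_meanZ _ HL a (fun=> 1)) ?(cube_mean1 _ HL) ?mulr1//; exact:
      continuous_cst.
rewrite ler_norml -{1}(Lc (- e)) -{2}(Lc e); apply/andP; split;
  apply: (cube_mean_le _ HL) => //; try exact: continuous_cst;
  by move=> z /ge; rewrite ler_norml => /andP[].
Qed.

(** The difference quotients of [G] in [s] converge to [dG] uniformly on the
    cube, by the mean value theorem and [compact_uniform]. *)
Lemma cube_mean_derive (G dG : R -> 'rV[R]_D -> R) (t : R) :
  (forall s, continuous (G s)) ->
  continuous (fun p : R * 'rV[R]_D => dG p.1 p.2) ->
  (forall (s : R) z, is_derive s 1 (fun s => G s z) (dG s z)) ->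
  is_derive t 1 (fun s => L (G s)) (L (dG t)).
Proof.
move=> Gc dGc GdG.
have dGtc s : continuous (dG s).
  move=> z; apply: (@continuous_comp _ _ _ (fun z => (s, z)) (fun p => dG p.1 p.2)).
    move=> A [[B C] /= [Bs Cz] BC]; apply: filterS Cz => z' Cz'.
    by apply: BC; split => //=; exact: nbhs_singleton Bs.
  exact: dGc.
apply: is_derive_cvg; apply/cvgrPdist_le => e e0.
have := @compact_uniform R R 'rV[R]_D _ _ t e (@cube_compact R D) dGc e0.
move=> /nbhs_ballP[r /= r0 rP].
near=> h.
have h0 : h != 0 by near: h; exact: nbhs_dnbhs_neq.
have hr : `|h| < r by near: h; exact: dnbhs0_lt.
have -> : L (dG t) - h^-1 *: (L (G (h *: 1 + t)) - L (G t)) =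
   L (fun z => dG t z + - h^-1 * (G (h + t) z + -1 * G t z)).
  have c1 : continuous (fun z => -1 * G t z) by apply: continuous_mul; [exact:
      continuous_cst|].
  have c2 : continuous (fun z => G (h + t) z + -1 * G t z) by exact: continuous_add.
  rewrite (cube_meanD _ HL)//; last by apply: continuous_mul; [exact: continuous_cst|].
  rewrite (cube_meanZ _ HL)// (cube_meanD _ HL)// (cube_meanZ _ HL)//.
  by rewrite mulN1r /GRing.scale /= mulNr mulr1.
apply: cube_mean_norm.
  apply: continuous_add => //; apply: continuous_mul; first exact: continuous_cst.
  apply: continuous_add => //; apply: continuous_mul => //; exact: continuous_cst.
move=> z z1.
have [s sr sE] : exists2 s, `|s - t| < r & G (h + t) z - G t z = dG s z * h.
  have Gcz a b : {within `[a, b], continuous (fun s => G s z)}.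
    apply: continuous_subspaceT => s; apply: differentiable_continuous.
    by apply/derivable1_diffP; have [+ _] := GdG s z.
  have [hlt|hgt] := ltP h 0.
    have [|s sI sE] := @MVT R (fun s => G s z) (fun s => dG s z) (h + t) t _ (fun s _
        => GdG s z) (Gcz _ _).
      lra.
    exists s; last by lra.
    move: sI; rewrite in_itv/= => /andP[s1 s2].
    by rewrite ltr0_norm in hr => //; rewrite ltr_norml; apply/andP; split; lra.
  have {}hgt : 0 < h by rewrite lt_neqAle eq_sym h0.
  have [|s sI sE] := @MVT R (fun s => G s z) (fun s => dG s z) t (h + t) _ (fun s _ =>
      GdG s z) (Gcz _ _).
    lra.
  exists s; last by lra.
  move: sI; rewrite in_itv/= => /andP[s1 s2].
  by rewrite gtr0_norm in hr => //; rewrite ltr_norml; apply/andP; split; lra.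
rewrite mulN1r sE mulNr mulrC mulfK// distrC; apply: rP => //.
by rewrite -ball_normE /= distrC.
Unshelve. all: by end_near.
Qed.

(** Weighted average of [u] over the ball of centre [c + s d] and radius
    [t0 + s t1]. *)
Definition moving_mean u c d (t0 t1 : R) (s : R) : R :=
  L (fun z => ball_weight z ^+ 2 * u (c + s *: d + (t0 + s * t1) *: z)).

Section moving.
Variables (u : 'rV[R]_D -> R) (uC2 : C2 u).

Lemma C1_continuous (g : 'rV[R]_D -> R) : C1 g -> continuous g.
Proof. by move=> [gd _] x; exact/differentiable_continuous/gd. Qed.

Lemma C2_partial_continuous i : continuous (partial i u).
Proof. by have [_ /(_ i)] := uC2; exact: C1_continuous. Qed.

Lemma C2_continuous : continuous u.
Proof. by have [+ _] := uC2; exact: C1_continuous. Qed.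

Lemma C2_partial2_continuous i : continuous (partial i (partial i u)).
Proof. by have [_ /(_ i) [_ /(_ i)]] := uC2. Qed.

Lemma continuous_affine (g : 'rV[R]_D -> R) c (t : R) : continuous g ->
  continuous (fun z => g (c + t *: z)).
Proof.
move=> gc z; apply: (@continuous_comp _ _ _ (fun z => c + t *: z)); last exact: gc.
apply: (continuous_add _ _ (fun=> c) (fun z => t *: z)); first exact: continuous_cst.
by apply: continuous_scale; [exact: continuous_cst|move=> ?; exact: cvg_id].
Qed.

Lemma is_derive_affine (g : 'rV[R]_D -> R) c (t : R) z i :
  (forall x, differentiable g x) ->
  is_derive z (delta_mx 0 i) (fun z => g (c + t *: z)) (t * partial i g (c + t *: z)).
Proof.
move=> gd; apply: is_derive_line0.
under eq_fun do rewrite scalerDr addrA scalerA mulrC -scalerA.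
apply: is_derive_line; rewrite scale0r addr0.
apply: (is_derive_eq (partial_line _ _ _ _ (gd _))).
rewrite (bigD1 i)//= big1 ?addr0; first by rewrite !mxE !eqxx mulr1.
by move=> j /negbTE ji; rewrite !mxE eqxx ji mulr0 mul0r.
Qed.

Lemma moving_mean_derive c d t0 t1 (s : R) :
  is_derive s 1 (moving_mean u c d t0 t1)
    (L (fun z => ball_weight z ^+ 2 * \sum_i (d + t1 *: z) 0 i *
        partial i u (c + s *: d + (t0 + s * t1) *: z))).
Proof.
pose dG s z := ball_weight z ^+ 2 * \sum_i (d + t1 *: z) 0 i *
        partial i u (c + s *: d + (t0 + s * t1) *: z).
apply: (cube_mean_derive (fun s z => ball_weight z ^+ 2 * u (c + s *: d + (t0 + s * t1)
    *: z)) dG).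
- move=> s'; apply: continuous_mul; first exact/continuous_pow/continuous_ball_weight.
  exact/continuous_affine/C2_continuous.
- have pc : continuous (fun p : R * 'rV[R]_D => c + p.1 *: d + (t0 + p.1 * t1) *: p.2).
    have fc : continuous (fun p : R * 'rV[R]_D => p.1) by move=> p; exact: cvg_fst.
    apply: continuous_add.
      by apply: continuous_add; [exact: continuous_cst|apply: continuous_scale => //;
          exact: continuous_cst].
    apply: continuous_scale; last by move=> p; exact: cvg_snd.
    apply: continuous_add; first exact: continuous_cst.
    by apply: continuous_mul => //; exact: continuous_cst.
  have sc (g : 'rV[R]_D -> R) : continuous g -> continuous (fun p : R * 'rV[R]_D => g p.2).
    move=> gc p; apply: (@continuous_comp _ _ _ snd); [exact: cvg_snd|exact: gc].
  apply: continuous_mul.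
    by apply: (sc (fun z => ball_weight z ^+ 2));
        exact/continuous_pow/continuous_ball_weight.
  apply: continuous_sum => i; apply: continuous_mul.
    apply: (sc (fun z => (d + t1 *: z) 0 i)).
    exact/(continuous_affine (fun z => z 0 i))/continuous_coord.
  exact/(continuous_compose _ _ _ _ (partial i u) pc)/C2_partial_continuous.
- move=> s' z; rewrite /dG.
  have h : is_derive s' 1 (fun s => u (c + s *: d + (t0 + s * t1) *: z))
     (\sum_i (d + t1 *: z) 0 i * partial i u (c + s' *: d + (t0 + s' * t1) *: z)).
    have E r : c + t0 *: z + r *: (d + t1 *: z) = c + r *: d + (t0 + r * t1) *: z.
      by rewrite scalerDr scalerDl !scalerA addrACA.
    under eq_fun do rewrite -E.
    by apply: is_derive_line; rewrite -E; apply: partial_line; have [[+ _] _] := uC2; apply.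
  have := is_deriveZ (ball_weight z ^+ 2) h; exact.
Qed.
End moving.
End averages.

(** * The Harnack inequality *)

Section harnack_inequality.
Context {R : realType} {D : nat}.
Implicit Types (x y z d c : 'rV[R]_D).

Lemma ball_weight_face z i : `|z 0 i| = 1 -> ball_weight z = 0.
Proof.
move=> z1; rewrite /ball_weight; apply/max_idPl.
rewrite subr_le0 /sqn (bigD1 i)//= -real_normK ?num_real// z1 expr1n lerDl.
by apply: sumr_ge0 => j _; exact: sqr_ge0.
Qed.

Lemma ball_weight_gt0 z : ball_weight z != 0 -> ball_weight z = 1 - sqn z /\ sqn z < 1.
Proof.
rewrite /ball_weight maxEle; case: ifPn => [h h0|_]; last by rewrite eqxx.
by split=> //; rewrite -subr_gt0 lt_neqAle eq_sym h0.
Qed.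

Lemma sqnZ (t : R) z : sqn (t *: z) = t ^+ 2 * sqn z.
Proof. by rewrite /sqn mulr_sumr; apply: eq_bigr => i _; rewrite !mxE exprMn. Qed.

Variable L : ('rV[R]_D -> R) -> R.
Hypothesis HL : cube_mean L.
Variables (u : 'rV[R]_D -> R) (uC2 : C2 u).
Hypothesis u_ge0 : forall x, 0 <= u x.
Hypothesis lap_ge0 : forall x, 0 <= laplacian u x.

Let ud : forall x, differentiable u x.
Proof. by case: uC2 => -[]. Qed.

Let pud i : forall x, differentiable (partial i u) x.
Proof. by case: uC2 => _ /(_ i)[]. Qed.

Let wc n : continuous (fun z : 'rV[R]_D => ball_weight z ^+ n).
Proof. exact/continuous_pow/continuous_ball_weight. Qed.

(** The vector field [ball_weight^3 grad u] vanishes outside the ball, so its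
    divergence has mean zero. *)
Lemma radial_by_parts x (t : R) :
  L (fun z => ball_weight z ^+ 2 * \sum_i z 0 i * partial i u (x + t *: z)) =
  t / 6 * L (fun z => ball_weight z ^+ 3 * laplacian u (x + t *: z)).
Proof.
pose dg i z := - 6 * ball_weight z ^+ 2 * z 0 i * partial i u (x + t *: z) +
  ball_weight z ^+ 3 * (t * partial i (partial i u) (x + t *: z)).
have pc i : continuous (fun z => partial i u (x + t *: z)).
  exact/continuous_affine/C2_partial_continuous.
have ppc i : continuous (fun z => partial i (partial i u) (x + t *: z)).
  exact/continuous_affine/C2_partial2_continuous.
have dgc i : continuous (dg i).
  apply: continuous_add; apply: continuous_mul => //.
    apply: continuous_mul; last exact: continuous_coord.
    by apply: continuous_mul => //; exact: continuous_cst.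
  by apply: continuous_mul => //; exact: continuous_cst.
have dg0 i : L (dg i) = 0.
  apply: (cube_mean_partial _ HL i (fun z => ball_weight z ^+ 3 * partial i u (x + t *:
      z))) => //.
  - exact: continuous_mul.
  - move=> z; apply: is_derive_mul; first exact: is_derive_ball_weight3.
    exact: is_derive_affine.
  - by move=> z /ball_weight_face ->; rewrite expr0n mul0r.
have : L (fun z => \sum_i dg i z) = 0.
  by rewrite (cube_mean_sum _ HL)// big1.
pose A z := ball_weight z ^+ 2 * \sum_i z 0 i * partial i u (x + t *: z).
pose B z := ball_weight z ^+ 3 * laplacian u (x + t *: z).
have Ac : continuous A.
  apply: continuous_mul => //; apply: continuous_sum => i; apply: continuous_mul => //.
  exact: continuous_coord.
have Bc : continuous B by apply: continuous_mul => //; exact: continuous_sum.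
have -> : (fun z => \sum_i dg i z) = (fun z => - 6 * A z + t * B z).
  apply/funext => z; rewrite /dg /A /B /laplacian big_split /= !mulr_sumr; congr (_ + _).
    by apply: eq_bigr => i _; ring.
  by apply: eq_bigr => i _; ring.
rewrite (cube_meanD _ HL); [|by apply: continuous_mul => //; exact: continuous_cst..].
rewrite !(cube_meanZ _ HL)// -/A -/B => h; lra.
Qed.

Let ballmean x (t : R) : R := moving_mean L u x 0 0 1 t.

Let ballmeanE x t : ballmean x t = L (fun z => ball_weight z ^+ 2 * u (x + t *: z)).
Proof.
rewrite /ballmean /moving_mean; congr L; apply/funext => z.
by rewrite scaler0 addr0 add0r mulr1.
Qed.

Let ballmean_derive x (t : R) : is_derive t 1 (ballmean x)
  (t / 6 * L (fun z => ball_weight z ^+ 3 * laplacian u (x + t *: z))).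
Proof.
rewrite -radial_by_parts.
apply: (is_derive_eq (moving_mean_derive L HL u uC2 x 0 0 1 t)).
congr L; apply/funext => z; congr (_ * _); apply: eq_bigr => i _.
by rewrite !scaler0 addr0 !add0r mulr1 scale1r.
Qed.

Let ballmean0 x : ballmean x 0 = u x * L (fun z => ball_weight z ^+ 2).
Proof.
rewrite ballmeanE -(cube_meanZ _ HL)//; congr L; apply/funext => z.
by rewrite scale0r addr0 mulrC.
Qed.

Let lapc : continuous (laplacian u).
Proof. by apply: continuous_sum => i; exact: C2_partial2_continuous. Qed.

Let lapxc x t : continuous (fun z => laplacian u (x + t *: z)).
Proof. exact: (continuous_affine (laplacian u) x t lapc). Qed.

Let uxc x t : continuous (fun z => u (x + t *: z)).
Proof. exact: (continuous_affine u x t (C2_continuous u uC2)). Qed.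

Let wlc x t : continuous (fun z => ball_weight z ^+ 3 * laplacian u (x + t *: z)).
Proof. exact: (continuous_mul _ _ _ (wc 3) (lapxc x t)). Qed.

Let wuc x t : continuous (fun z => ball_weight z ^+ 2 * u (x + t *: z)).
Proof. exact: (continuous_mul _ _ _ (wc 2) (uxc x t)). Qed.

Let czc (k : R) g : continuous g -> continuous (fun z : 'rV[R]_D => k * g z).
Proof. by move=> gc; apply: continuous_mul => //; exact: continuous_cst. Qed.

(** Averages of a subharmonic function grow with the radius. *)
Lemma ballmean_ge x (T : R) : 0 <= T -> ballmean x 0 <= ballmean x T.
Proof.
move=> T0; have := gronwall _ _ 0 T T0 (ballmean_derive x).
rewrite mul0r expR0 mul1r; apply => t /andP[t0 _].
rewrite oppr0 mul0r mulr_ge0 ?divr_ge0//.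
have -> : 0 = L (fun=> 0 * 1).
  by rewrite (cube_meanZ _ HL 0 (fun=> 1)) ?mul0r//; exact: continuous_cst.
apply: (cube_mean_le _ HL).
- exact: continuous_cst.
- exact: wlc.
- by move=> z _; rewrite mul0r mulr_ge0// exprn_ge0// ball_weight_ge0.
Qed.

(** Inside the ball [ball_weight^3 <= ball_weight^2], so that
    [radial_by_parts] bounds the derivative of the average by the average
    itself. *)
Lemma ballmean_le x (T k : R) : 0 <= T -> 0 <= k ->
  (forall y, sqn (y - x) <= T ^+ 2 -> laplacian u y <= k * u y) ->
  ballmean x T <= expR (k * T ^+ 2) * ballmean x 0.
Proof.
move=> T0 k0 lapk.
have dN (t : R) := is_deriveN (ballmean_derive x t).
have := gronwall _ _ (- (k * T)) T T0 dN.
rewrite mulNr -mulrA -expr2 => h.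
have {h} : - ballmean x 0 <= expR (- (k * T ^+ 2)) * - ballmean x T.
  apply: h => t /andP[t0 tT]; rewrite opprK mulrN lerN2.
  rewrite ballmeanE -(cube_meanZ _ HL (k * T))//.
  rewrite -(cube_meanZ _ HL (t / 6))//.
  apply: (cube_mean_le _ HL); [exact/czc/wlc|exact/czc/wuc|].
  - move=> z _; have [w0|/ball_weight_gt0 [_ z1]] := eqVneq (ball_weight z) 0.
      by rewrite w0 !expr0n /= !mul0r !mulr0.
    have := ball_weight_ge0 z; have := ball_weight_le1 z.
    have lz := lap_ge0 (x + t *: z); have uz := u_ge0 (x + t *: z).
    have : laplacian u (x + t *: z) <= k * u (x + t *: z).
      apply: lapk; rewrite addrAC subrr add0r sqnZ.
      have z0 := sqn_ge0 z.
      by apply: (@le_trans _ _ (t ^+ 2 * 1)); [rewrite ler_wpM2l ?sqr_ge0// ltW|rewrite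
          mulr1 ler_sqr ?nnegrE].
    move: (ball_weight z) (laplacian u _) lz (u _) uz => w l l0 v v0 lk w1 w0.
    have kv : 0 <= k * v by rewrite mulr_ge0.
    have h1 : w ^+ 3 * l <= w ^+ 2 * (k * v).
      apply: ler_pM => //; rewrite ?exprn_ge0//.
      by rewrite exprS ler_piMl// exprn_ge0.
    apply: (@le_trans _ _ (t / 6 * (w ^+ 2 * (k * v)))).
      by rewrite ler_wpM2l// divr_ge0.
    rewrite [leRHS](_ : _ = T * (w ^+ 2 * (k * v))); last by ring.
    rewrite ler_wpM2r//; first by rewrite mulr_ge0// exprn_ge0.
    by rewrite ler_pdivrMr//; nra.
rewrite mulrN lerN2 expRN ler_pdivrMl ?expR_gt0//.
Qed.

(** The ball slides from [y] to [x] while its radius grows from [l] to [3 l],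
    that is, twice as fast as the centre moves. At a fixed point of
    space the weight then increases near the boundary of the ball, where it
    degenerates, and inside it decreases at most at a rate proportional to
    itself, as an integration by parts shows. *)
Lemma ballmean_move x y (l : R) : 0 < l -> sqn (x - y) <= l ^+ 2 ->
  ballmean y l <= expR (4 + 2 * D%:R) * ballmean x (3 * l).
Proof.
move=> l0 xyl; set d := x - y in xyl *.
have E0 : ballmean y l = moving_mean L u y d l (2 * l) 0.
  rewrite ballmeanE /moving_mean; congr L; apply/funext => z.
  by rewrite scale0r addr0 mul0r addr0.
have E1 : ballmean x (3 * l) = moving_mean L u y d l (2 * l) 1.
  rewrite ballmeanE /moving_mean; congr L; apply/funext => z.
  rewrite scale1r mul1r (_ : y + d = x); last by rewrite /d addrC subrK.
  by congr (_ * u (_ + _ *: _)); ring.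
rewrite E0 E1 -[4 + _]mulr1.
apply: (gronwall _ _ _ _ ler01 (moving_mean_derive L HL u uC2 y d l (2 * l))) => s
    /andP[s0 s1].
set t := l + s * (2 * l).
have lt : l <= t by rewrite /t lerDl !mulr_ge0// ltW.
have t0 : 0 < t by exact: lt_le_trans lt.
pose c := y + s *: d.
have pc i : continuous (fun z => partial i u (c + t *: z)).
  exact/continuous_affine/C2_partial_continuous.
have uc : continuous (fun z => u (c + t *: z)).
  exact/continuous_affine/C2_continuous.
have vc i : continuous (fun z => (d + (2 * l) *: z) 0 i).
  exact/(continuous_affine (fun z => z 0 i))/continuous_coord.
pose dg i z := (- 4 * ball_weight z * z 0 i * (d + (2 * l) *: z) 0 i + ball_weight z ^+
    2 * (2 * l)) * u (c + t *: z) +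
  (ball_weight z ^+ 2 * (d + (2 * l) *: z) 0 i) * (t * partial i u (c + t *: z)).
have dgc i : continuous (dg i).
  apply: continuous_add; apply: continuous_mul => //.
  - apply: continuous_add; apply: continuous_mul => //; last exact: continuous_cst.
    apply: continuous_mul; last exact: continuous_coord.
    by apply: continuous_mul; [exact: continuous_cst|exact: continuous_ball_weight].
  - exact: continuous_mul.
  - by apply: continuous_mul => //; exact: continuous_cst.
have dg0 i : L (dg i) = 0.
  apply: (cube_mean_partial _ HL i (fun z => (ball_weight z ^+ 2 * (d + (2 * l) *: z) 0
      i) * u (c + t *: z))) => //.
  - by apply: continuous_mul => //; apply: continuous_mul.
  - move=> z; apply: is_derive_mul; last exact: is_derive_affine.
    apply: is_derive_mul; first exact: is_derive_ball_weight2.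
    have := @is_derive_affine R D (fun z => z 0 i) d (2 * l) z i.
    rewrite /partial => h; apply: (is_derive_eq (h _)).
      by move=> z'; apply: differentiable_coord.
    have [_ ->] := is_derive_coord (d + (2 * l) *: z) i i.
    by rewrite eqxx mulr1.
  - by move=> z /ball_weight_face ->; rewrite expr0n /= !mul0r.
pose A z := ball_weight z ^+ 2 * \sum_i (d + (2 * l) *: z) 0 i * partial i u (c + t *: z).
have Ac : continuous A.
  by apply: continuous_mul => //; apply: continuous_sum => i; apply: continuous_mul.
have Bc : continuous (fun z => ball_weight z ^+ 2 * u (c + t *: z)) by exact:
    continuous_mul.
rewrite -/c -/A; change (- (4 + 2 * D%:R) * L (fun z => ball_weight z ^+ 2 * u (c + t
    *: z)) <= L A).
set B := fun z => _ in Bc *.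
have key : - (l * (4 + 2 * D%:R)) * L B <= t * L A.
  have Sc : continuous (fun z => \sum_i dg i z) by exact: continuous_sum.
  have S0 : L (fun z => \sum_i dg i z) = 0.
    by rewrite (cube_mean_sum _ HL)// big1.
  rewrite -(cube_meanZ _ HL (- (l * (4 + 2 * D%:R))) B Bc).
  have -> : t * L A = L (fun z => t * A z + -1 * \sum_i dg i z).
    rewrite (cube_meanD _ HL _ _ (czc t _ Ac) (czc (-1) _ Sc)).
    by rewrite (cube_meanZ _ HL t A Ac) (cube_meanZ _ HL (-1) _ Sc) S0 mulr0 addr0.
  apply: (cube_mean_le _ HL).
  - exact: czc.
  - by apply: continuous_add; exact: czc.
  - move=> z _.
    have -> : \sum_i dg i z = (- 4 * ball_weight z * (\sum_i z 0 i * d 0 i + 2 * l * sqn z)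
        + 2 * l * D%:R * ball_weight z ^+ 2) * u (c + t *: z) + t * A z.
      rewrite /dg big_split /= -mulr_suml big_split /= sumr_const card_ord; congr (_ *
          _ + _).
        congr (_ + _); last by rewrite -mulr_natr; ring.
        rewrite /sqn mulrDr !mulr_sumr -big_split; apply: eq_bigr => i _.
        by rewrite !mxE /=; ring.
      by rewrite /A !mulr_sumr; apply: eq_bigr => i _; ring.
    have [w0|/ball_weight_gt0 [wE z1]] := eqVneq (ball_weight z) 0.
      by rewrite /A /B w0 !expr0n /= !(mul0r, mulr0, addr0).
    (* |l z + d|^2 >= 0 replaces the Cauchy-Schwarz inequality *)
    have zd : 0 <= l ^+ 2 * sqn z + 2 * l * (\sum_i z 0 i * d 0 i) + sqn d.
      rewrite /sqn !mulr_sumr -!big_split /=; apply: sumr_ge0 => i _.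
      rewrite (_ : _ + _ = (l * z 0 i + d 0 i) ^+ 2) ?sqr_ge0//; ring.
    have zdl : - (l * (sqn z + 1)) <= 2 * (\sum_i z 0 i * d 0 i).
      rewrite -(@ler_pM2l _ l)//; nra.
    have w0 := ball_weight_ge0 z.
    have : - l * ball_weight z <= \sum_i z 0 i * d 0 i + 2 * l * sqn z.
      have := sqn_ge0 z; rewrite wE; nra.
    have uz := u_ge0 (c + t *: z).
    rewrite /B mulN1r; move: (A z) (\sum_i _ + _) (ball_weight z) w0 (u _) uz => a b w
        w0 v v0 bw.
    have : 0 <= 4 * w * (b + l * w) * v by rewrite !mulr_ge0//; lra.
    nra.
have LB0 : 0 <= L B.
  have -> : 0 = L (fun=> 0 * 1).
    by rewrite (cube_meanZ _ HL 0 (fun=> 1)) ?mul0r//; exact: continuous_cst.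
  apply: (cube_mean_le _ HL) => //; first exact: continuous_cst.
  by move=> z _; rewrite mul0r mulr_ge0// sqr_ge0.
rewrite -(@ler_pM2l _ t)//; apply: le_trans key.
by rewrite mulrA ler_wpM2r// mulrN lerN2 ler_wpM2r// addr_ge0// mulr_ge0.
Qed.

(** [u(y)] is below the average over the ball of radius [l] around [y], which is
    controlled by the average over the ball of radius [3 l] around [x], which is
    controlled by [u(x)]. *)
Lemma harnack x y (l k : R) : 0 < l -> 0 <= k -> sqn (x - y) <= l ^+ 2 ->
  (forall x', sqn (x' - x) <= (3 * l) ^+ 2 -> laplacian u x' <= k * u x') ->
  u y <= expR (4 + 2 * D%:R + k * (3 * l) ^+ 2) * u x.
Proof.
move=> l0 k0 xy lapk.
have w0 : 0 < L (fun z => ball_weight z ^+ 2).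
  apply: (cube_mean_gt0 _ HL _ (2^-1 ^+ 2)) => //.
    by move=> z; exact: sqr_ge0.
  move=> z zD; rewrite ler_sqr ?nnegrE ?ball_weight_ge0// /ball_weight le_max.
  apply/orP; right; rewrite lerBrDr -lerBrDl (_ : 1 - 2^-1 = 2^-1); last lra.
  have zi i : z 0 i ^+ 2 <= (2 * D.+1)%:R^-1.
    rewrite -real_normK ?num_real// expr2 -[leRHS]mul1r ler_pM//.
      apply: (le_trans (rV_coord_le _ _ _)); apply: (le_trans zD).
      by rewrite invf_le1 ?ltr0n// ler1n.
    exact: le_trans (rV_coord_le _ _ _) zD.
  apply: (le_trans (ler_sum _ (fun i _ => zi i))).
  rewrite sumr_const card_ord -[X in X <= _]mulr_natl natrM ler_pdivrMr ?mulr_gt0 ?ltr0n//.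
  by rewrite mulrA mulVf// mul1r ler_nat.
have l30 : 0 <= 3 * l by rewrite mulr_ge0// ltW.
rewrite -(ler_pM2r w0) -mulrA -!ballmean0 expRD -mulrA.
apply: le_trans (ballmean_ge _ _ (ltW l0)) _.
apply: le_trans (ballmean_move _ _ _ l0 xy) _.
by rewrite ler_wpM2l ?expR_ge0//; exact: ballmean_le.
Qed.
End harnack_inequality.

(** * One-dimensional analysis of the nonlinearity *)

Section half_line.
Context {R : realType}.
Variable f : R -> R.
Hypothesis f_C1 : C1_half_line f.

(** A Lipschitz bound at each point, one-sided at [0], gives both the continuity
    of [f] and the boundedness of [f t / t] near [0]. *)
Lemma C1_half_line_lipschitz (t : R) : 0 <= t -> exists C d : R,
  [/\ 0 <= C, 0 < d & forall s, 0 <= s -> `|s - t| < d ->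
      `|f s - f t| <= C * `|s - t|].
Proof.
case: f_C1 => f' _ f'P t0.
have /cvgrPdist_lt /(_ _ ltr01) := f'P t t0.
rewrite /prop_near1 /= /within /dnbhs /= => /nbhs_ballP[d /= d0 dP].
exists (`|f' t| + 1), d; split => //.
move=> s s0 sd; have [->|st] := eqVneq s t; first by rewrite !subrr normr0 mulr0.
have st0 : 0 < `|s - t| by rewrite normr_gt0 subr_eq0.
have : `|f' t - (f s - f t) / (s - t)| < 1.
  by apply: dP => //; rewrite -ball_normE /= distrC.
move=> h; rewrite -ler_pdivrMr// -normf_div.
have := ler_distD (f' t) 0 ((f s - f t) / (s - t)).
rewrite !sub0r !normrN; lra.
Qed.

Lemma C1_half_line_continuous (t : R) : 0 < t -> {for t, continuous f}.
Proof.
move=> t0; have [C [d [C0 d0 fC]]] := C1_half_line_lipschitz t (ltW t0).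
apply/cvgrPdist_lt => e e0.
have m0 : 0 < Num.min t (Num.min d (e / (C + 1))).
  by rewrite !lt_min t0 d0 divr_gt0//; lra.
have /cvgrPdist_lt /(_ _ m0) := @cvg_id _ (nbhs t).
apply: filterS => s; rewrite !lt_min => /and3P[st].
rewrite distrC => sd; rewrite ltr_pdivlMr; last lra.
have s0 : 0 <= s by move: st; rewrite ltr_norml => /andP[]; lra.
move=> se; rewrite distrC; apply: le_lt_trans (fC _ s0 sd) _.
apply: le_lt_trans se; rewrite mulrC ler_wpM2l//; lra.
Qed.

Lemma C1_half_line_ratio_bounded (M : R) : f 0 = 0 ->
  exists2 B : R, 0 <= B & forall s, 0 < s -> s <= M -> f s <= B * s.
Proof.
move=> f0; have [C [d [C0 d0 fC]]] := C1_half_line_lipschitz 0 (lexx _).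
have [md|dm] := ltP M d.
  exists C => // s s0 sM; have := fC s (ltW s0).
  rewrite f0 !subr0 (gtr0_norm s0) => /(_ (le_lt_trans sM md)).
  by apply: le_trans; exact: ler_norm.
have fcont : {within `[d, M], continuous f}.
  apply: continuous_in_subspaceT => s; rewrite inE /= in_itv/= => /andP[ds _].
  exact/C1_half_line_continuous/lt_le_trans/ds.
have [c cI cM] := EVT_max dm fcont.
exists (C + `|f c| / d); first by rewrite addr_ge0// divr_ge0// ltW.
move=> s s0 sM; have [sd|ds] := ltP s d.
  have := fC s (ltW s0); rewrite f0 !subr0 (gtr0_norm s0) => /(_ sd).
  move=> h; apply: le_trans (ler_norm _) _; apply: le_trans h _.
  by rewrite ler_wpM2r ?(ltW s0)// lerDl divr_ge0// ltW.
apply: (@le_trans _ _ (f c)); first by apply: cM; rewrite in_itv/= ds.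
apply: (le_trans (ler_norm _)); rewrite mulrDl.
apply: (@le_trans _ _ (`|f c| / d * s)); last by rewrite lerDr mulr_ge0// ltW.
by rewrite -mulrA ler_peMr// mulrC ler_pdivlMr// mul1r.
Qed.

Lemma C1_half_line_integrable (b c : R) : 0 < b ->
  lebesgue_measure.-integrable `[b, c] (EFin \o f).
Proof.
move=> b0; apply: continuous_compact_integrable; first exact: segment_compact.
apply: continuous_in_subspaceT => s; rewrite inE /= in_itv/= => /andP[bs _].
exact/C1_half_line_continuous/lt_le_trans/bs.
Qed.

Lemma Rintegral_itv_split (b c d : R) : 0 < b -> b <= c -> c <= d ->
  \int[lebesgue_measure]_(t in `[b, d]) f t =
  \int[lebesgue_measure]_(t in `[b, c]) f t + \int[lebesgue_measure]_(t in `[c, d]) f t.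
Proof.
move=> b0 bc cd; have fi := C1_half_line_integrable b d b0.
have := @Rintegral_itvB R f (BLeft b) (BRight d) c fi.
rewrite !bnd_simp => /(_ bc cd); rewrite Rintegral_itv_obnd_cbnd; first by move=> <-;
    rewrite addrC subrK.
apply: integrableS fi => //; apply: subset_itv; rewrite bnd_simp//.
Qed.

Lemma primitiveB (a v y : R) : 0 < a -> 0 < v -> v <= y ->
  primitive a f y - primitive a f v = \int[lebesgue_measure]_(t in `[v, y]) f t.
Proof.
move=> a0 v0 vy; rewrite /primitive.
case: (leP a v) => av.
  by rewrite (le_trans av vy) (Rintegral_itv_split a v y)// addrC addKr.
case: (leP a y) => ay.
  by rewrite opprK (Rintegral_itv_split v a y)// ?ltW// addrC.
by rewrite opprK (Rintegral_itv_split v y a)// ?ltW//; lra.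
Qed.

Hypothesis f_gt0 : forall t, 0 < t -> 0 < f t.

(** If [v'' = f(v)] starts at rest from the value [v], half the squared speed at
    the value [y] is [energy v y]. *)
Definition energy (v y : R) : R := \int[lebesgue_measure]_(t in `[v, y]) f t.

Lemma energy_derive (v y : R) : 0 < v -> v < y -> is_derive y 1 (energy v) (f y).
Proof.
move=> v0 vy.
have [|||h1 h2] := @continuous_FTC1 R f (BLeft v) y (y + 1) _ (C1_half_line_integrable
    v (y + 1) v0).
- by rewrite ltrDl.
- by rewrite lte_fin.
- exact/C1_half_line_continuous/lt_trans/vy.
by split; [exact: h1|rewrite -derive1E; exact: h2].
Qed.

Lemma energy_bounds (v y A B : R) : 0 < v -> v < y ->
  (forall t, v <= t <= y -> A <= f t <= B) ->
  A * (y - v) <= energy v y <= B * (y - v).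
Proof.
move=> v0 vy fAB.
have len c : \int[lebesgue_measure]_(t in `[v, y]) c = c * (y - v).
  rewrite Rintegral_cst//; congr (_ * _).
  by have /= -> := lebesgue_measure_itv `[v, y]; rewrite lte_fin vy.
have ic (c : R) : lebesgue_measure.-integrable `[v, y] (EFin \o fun=> c).
  apply: continuous_compact_integrable; first exact: segment_compact.
  by move=> ?; exact: cvg_cst.
rewrite -!len; apply/andP; split; apply: le_Rintegral => //; try exact:
    C1_half_line_integrable;
  by move=> t /=; rewrite in_itv /= => /fAB /andP[].
Qed.

Lemma energy_gt0 (v y : R) : 0 < v -> v < y -> 0 < energy v y.
Proof.
move=> v0 vy.
have fcont : {within `[v, y], continuous f}.
  apply: continuous_in_subspaceT => s; rewrite inE /= in_itv/= => /andP[bs _].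
  exact/C1_half_line_continuous/lt_le_trans/bs.
have [c cI cM] := EVT_min (ltW vy) fcont.
have [d dI dM] := EVT_max (ltW vy) fcont.
have /andP[h _] : f c * (y - v) <= energy v y <= f d * (y - v).
  by apply: energy_bounds => // t tI; rewrite cM// dM.
apply: lt_le_trans h; rewrite mulr_gt0 ?subr_gt0//; apply: f_gt0.
by move: cI; rewrite in_itv/= => /andP[/(lt_le_trans v0)].
Qed.

Definition speed_inv (v y : R) : R := (Num.sqrt (energy v y))^-1.

Lemma speed_inv_gt0 (v y : R) : 0 < v -> v < y -> 0 < speed_inv v y.
Proof. by move=> v0 vy; rewrite invr_gt0 sqrtr_gt0 energy_gt0. Qed.

Lemma speed_inv_derive (v y : R) : 0 < v -> v < y ->
  is_derive y 1 (speed_inv v) (- (f y * speed_inv v y ^+ 3 / 2)).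
Proof.
move=> v0 vy; have G0 := energy_gt0 v y v0 vy.
have s0 : Num.sqrt (energy v y) != 0 by rewrite gt_eqF ?sqrtr_gt0.
have h : is_derive y 1 (fun y => Num.sqrt (energy v y)) ((2 * Num.sqrt (energy v y))^-1
    * f y).
  exact: (is_derive1_comp (is_derive1_sqrt G0) (energy_derive v y v0 vy)).
have hV := @is_deriveV R (fun y => Num.sqrt (energy v y)) y _ 1 s0 h.
suff -> : - (f y * speed_inv v y ^+ 3 / 2) = - Num.sqrt (energy v y) ^- 2 *: ((2 *
    Num.sqrt (energy v y))^-1 * f y) by exact: hV.
by rewrite /speed_inv /GRing.scale /=; field.
Qed.

Lemma speed_inv_continuous (v y : R) : 0 < v -> v < y -> {for y, continuous (speed_inv v)}.
Proof.
move=> v0 vy; apply: differentiable_continuous; apply/derivable1_diffP.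
by have [+ _] := speed_inv_derive v y v0 vy.
Qed.

Lemma Phi_energy (a v : R) : 0 < a -> 0 < v ->
  Phi a f v = \int[lebesgue_measure]_(t in `]v, +oo[) speed_inv v t.
Proof.
move=> a0 v0; apply: eq_Rintegral => t; rewrite inE/= in_itv/= andbT => vt.
by rewrite primitiveB// ltW.
Qed.

(** The real-valued integral defining [Phi] would be [0] if it diverged. *)
Lemma Phi_integrable (a v : R) : 0 < a -> 0 < v -> Phi a f v != 0 ->
  lebesgue_measure.-integrable `]v, +oo[ (EFin \o speed_inv v).
Proof.
move=> a0 v0; rewrite Phi_energy// /Rintegral => P0.
apply/integrableP; split.
  apply/measurable_realfun.measurable_EFinP; apply:
      measurable_realfun.open_continuous_measurable_fun => // t.
  by rewrite inE/= in_itv/= andbT => vt; exact: speed_inv_continuous.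
rewrite (_ : (\int[_]_(x in _) _)%E = (\int[lebesgue_measure]_(t in `]v, +oo[)
    (speed_inv v t)%:E)%E); last first.
  apply: eq_integral => t; rewrite inE/= in_itv/= andbT => vt.
  by rewrite gtr0_norm// speed_inv_gt0.
rewrite ltey; apply: contra_neq P0 => /= ->.
by [].
Qed.

(** Up to a factor [sqrt 2], the time needed by the one-dimensional solution to
    climb from [v] to [y]; [Phi a f v] is the blow-up time. *)
Definition travel_time (v y : R) : R := \int[lebesgue_measure]_(t in `]v, y]) speed_inv v t.

Section travel_time.
Variables (a v : R).
Hypotheses (a0 : 0 < a) (v0 : 0 < v) (Phi_neq0 : Phi a f v != 0).

Lemma travel_time_integrable y : lebesgue_measure.-integrable `]v, y] (EFin \o speed_inv v).
Proof.
apply: integrableS (Phi_integrable _ _ a0 v0 Phi_neq0) => //.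
by apply: subset_itv; rewrite bnd_simp.
Qed.

Lemma travel_time_derive y : v < y -> is_derive y 1 (travel_time v) (speed_inv v y).
Proof.
move=> vy.
have [|||h1 h2] := @continuous_FTC1 R (speed_inv v) (BRight v) y (y + 1) _
    (travel_time_integrable _).
- by rewrite ltrDl.
- by rewrite lte_fin.
- exact: speed_inv_continuous.
by split; [exact: h1|rewrite -derive1E; exact: h2].
Qed.

Lemma travel_time_increasing y y' : v < y -> y < y' -> travel_time v y < travel_time v y'.
Proof.
move=> vy yy'.
have h (s : R) : s \in `]y, y'[ -> is_derive s 1 (travel_time v) (speed_inv v s).
  by rewrite in_itv/= => /andP[ys _]; apply: travel_time_derive; exact: lt_trans ys.
have [|c cI cE] := MVT yy' h.
  apply: continuous_in_subspaceT => s; rewrite inE /= in_itv/= => /andP[ys _].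
  apply: differentiable_continuous; apply/derivable1_diffP.
  by have [+ _] := travel_time_derive s (lt_le_trans vy ys).
rewrite -subr_gt0 cE mulr_gt0 ?subr_gt0//; apply: speed_inv_gt0 => //.
by move: cI; rewrite in_itv/= => /andP[yc _]; exact: lt_trans yc.
Qed.

Lemma travel_time_le_Phi y : v < y -> travel_time v y <= Phi a f v.
Proof.
move=> vy; rewrite Phi_energy// /travel_time /Rintegral.
have iP := Phi_integrable a v a0 v0 Phi_neq0.
apply: fine_le.
- exact: integrable_fin_num (travel_time_integrable y).
- exact: integrable_fin_num iP.
apply: ge0_subset_integral => //.
- by have /integrableP[] := iP.
- move=> t /=; rewrite in_itv/= andbT => vt.
  by rewrite lee_fin ltW// speed_inv_gt0.
- by apply: subset_itv; rewrite bnd_simp.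
Qed.

Hypothesis f_nd : forall s t, v <= s -> s <= t -> f s <= f t.

Lemma energy_increasing y y' : v < y -> y <= y' -> energy v y <= energy v y'.
Proof.
move=> vy yy'; rewrite /energy (Rintegral_itv_split v y y' v0 (ltW vy) yy') lerDl.
apply: Rintegral_ge0 => t /=; rewrite in_itv/= => /andP[yt _].
by rewrite ltW// f_gt0//; exact: lt_trans v0 (lt_le_trans vy yt).
Qed.

Lemma travel_time_ge y : v < y -> (y - v) * speed_inv v y <= travel_time v y.
Proof.
move=> vy.
have <- : \int[lebesgue_measure]_(t in `]v, y]) speed_inv v y = (y - v) * speed_inv v y.
  rewrite Rintegral_cst// mulrC; congr (_ * _).
  by have /= -> := lebesgue_measure_itv `]v, y]; rewrite lte_fin vy.
have ic : lebesgue_measure.-integrable `]v, y] (EFin \o fun=> speed_inv v y).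
  have h : lebesgue_measure.-integrable `[v, y] (EFin \o fun=> speed_inv v y).
    apply: continuous_compact_integrable; first exact: segment_compact.
    by move=> ?; exact: cvg_cst.
  by apply: integrableS h => //; apply: subset_itv; rewrite bnd_simp.
apply: le_Rintegral => //.
  exact: travel_time_integrable.
move=> t /=; rewrite in_itv/= => /andP[vt ty].
have Gt := energy_gt0 v t v0 vt; have Gy := energy_gt0 v y v0 vy.
rewrite /speed_inv lef_pV2 ?posrE ?sqrtr_gt0//.
by apply: ler_wsqrtr; apply: energy_increasing.
Qed.

Lemma travel_time_gt0 y : v < y -> 0 < travel_time v y.
Proof.
move=> vy; apply: lt_le_trans (travel_time_ge y vy).
by rewrite mulr_gt0 ?subr_gt0// speed_inv_gt0.
Qed.

(** Since [f] is nondecreasing beyond [v], the energy is at most [(y - v) f(y)],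
    while the travel time is at least [(y - v) / sqrt (energy)]. *)
Lemma travel_time_force_ge1 y : v < y -> 1 <= travel_time v y * f y * speed_inv v y.
Proof.
move=> vy; have G0 := energy_gt0 v y v0 vy.
have fy : 0 < f y by apply: f_gt0; exact: lt_trans vy.
have /andP[_ h] : f v * (y - v) <= energy v y <= f y * (y - v).
  by apply: energy_bounds => // t /andP[vt ty]; rewrite !f_nd.
have g0 := speed_inv_gt0 v y v0 vy.
have gE : energy v y * speed_inv v y ^+ 2 = 1.
  by rewrite /speed_inv exprVn sqr_sqrtr ?ltW// divff ?gt_eqF.
rewrite -gE; have := travel_time_ge y vy => h2.
apply: (@le_trans _ _ (f y * (y - v) * speed_inv v y ^+ 2)).
  by rewrite ler_wpM2r// sqr_ge0.
rewrite (_ : f y * (y - v) * _ = (y - v) * speed_inv v y * (f y * speed_inv v y)); last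
    by ring.
rewrite -[leRHS]mulrA ler_wpM2r// mulr_ge0// ltW//.
Qed.
End travel_time.
End half_line.

(** * Maximum principle and Keller-Osserman bound *)

Section maximum.
Context {R : realType}.

(** If [m > 0] then [dg > 0] just to the right of [0], so [g] would increase
    there. *)
Lemma second_derivative_max (g dg : R -> R) (m e : R) : 0 < e ->
  (forall s : R, `|s| < e -> is_derive s 1 g (dg s)) ->
  is_derive (0 : R) 1 dg m ->
  (forall s, `|s| < e -> g s <= g 0) -> dg 0 = 0 /\ m <= 0.
Proof.
move=> e0 gdg dgm gmax.
have I s : s \in `]-e, e[ -> `|s| < e by rewrite in_itv/= ltr_norml.
have dg0 : dg 0 = 0.
  have h : is_derive (0 : R) 1 g 0.
    apply: (@derive1_at_max R g (- e) e 0).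
    - by lra.
    - by move=> t /I /gdg[].
    - by rewrite in_itv/= oppr_lt0 e0.
    - by move=> t /I; exact: gmax.
  have n0 : `|0 : R| < e by rewrite normr0.
  have [_ h1] := gdg 0 n0; have [_ h2] := h.
  by rewrite -h1 h2.
split=> //; rewrite leNgt; apply/negP => m0.
have [dgd dgE] := dgm.
have /cvgrPdist_lt /(_ _ m0) : (fun h : R => h^-1 *: (dg (h *: 1 + 0) - dg 0)) @ 0^' --> m.
  by rewrite -dgE; exact: dgd.
rewrite /prop_near1 /= /within /dnbhs /= => /nbhs_ballP[r /= r0 rP].
pose s := Num.min e r / 2.
have mer : 0 < Num.min e r by rewrite lt_min e0.
have s0 : 0 < s by rewrite divr_gt0.
have : s < Num.min e r by rewrite /s; lra.
rewrite lt_min => /andP[se sr].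
have dgpos t : 0 < t -> t <= s -> 0 < dg t.
  move=> t0 ts.
  have : `|m - t^-1 *: (dg (t *: 1 + 0) - dg 0)| < m.
    apply: rP; last by rewrite gt_eqF.
    by rewrite -ball_normE /= sub0r normrN gtr0_norm// (le_lt_trans ts).
  rewrite dg0 subr0 addr0 [t *: 1](mulr1) ltr_norml => /andP[_].
  rewrite ltrBlDr ltrDl => h.
  by move: h; rewrite /GRing.scale /= pmulr_rgt0 ?invr_gt0.
have gs : forall t : R, t \in `]0, s[ -> is_derive t 1 g (dg t).
  move=> t; rewrite in_itv/= => /andP[t0 ts]; apply: gdg.
  by rewrite gtr0_norm// (lt_trans ts).
have [|c] := MVT s0 gs.
  apply: continuous_in_subspaceT => t; rewrite inE /= in_itv/= => /andP[t0 ts].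
  apply: differentiable_continuous; apply/derivable1_diffP.
  have [] // := gdg t; first by rewrite ger0_norm// (le_lt_trans ts).
rewrite in_itv/= subr0 => /andP[c0 cs] cE.
have : g s <= g 0 by apply: gmax; rewrite gtr0_norm.
rewrite -subr_le0 cE leNgt mulr_gt0// dgpos// ltW//.
Qed.

Section C2_max.
Context {D : nat} (u : 'rV[R]_D -> R).
Hypothesis uC2 : C2 u.

Let ud : forall x, differentiable u x.
Proof. by case: uC2 => -[]. Qed.

Let pud i : forall x, differentiable (partial i u) x.
Proof. by case: uC2 => _ /(_ i)[]. Qed.

Lemma partial_is_derive x i (s : R) :
  is_derive s 1 (fun s => u (x + s *: delta_mx 0 i)) (partial i u (x + s *: delta_mx 0 i)).
Proof.
apply: is_derive_line; apply: (is_derive_eq (partial_line _ _ _ _ (ud _))).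
rewrite (bigD1 i)//= big1 ?addr0; first by rewrite !mxE !eqxx mul1r.
by move=> j /negbTE ji; rewrite !mxE eqxx ji mul0r.
Qed.

Lemma partial2_is_derive x i (s : R) :
  is_derive s 1 (fun s => partial i u (x + s *: delta_mx 0 i))
    (partial i (partial i u) (x + s *: delta_mx 0 i)).
Proof.
apply: is_derive_line; apply: (is_derive_eq (partial_line _ _ _ _ (pud i _))).
rewrite (bigD1 i)//= big1 ?addr0; first by rewrite !mxE !eqxx mul1r.
by move=> j /negbTE ji; rewrite !mxE eqxx ji mul0r.
Qed.

Lemma near_line (x v : 'rV[R]_D) (P : 'rV[R]_D -> Prop) : (\forall y \near x, P y) ->
  exists2 e : R, 0 < e & forall s : R, `|s| < e -> P (x + s *: v).
Proof.
move=> xP.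
have c : (fun s : R => x + s *: v) @ (0 : R) --> x + (0 : R) *: v.
  apply: (continuous_add _ _ (fun=> x) (fun s : R => s *: v)); first exact: continuous_cst.
  by apply: continuous_scale; [move=> ?; exact: cvg_id|exact: continuous_cst].
rewrite scale0r addr0 in c; have := c _ xP.
move=> /nbhs_ballP[e /= e0 eP]; exists e => // s se.
by apply: eP; rewrite -ball_normE /= sub0r normrN.
Qed.

Lemma laplacian_max x : (\forall y \near x, u y <= u x) -> laplacian u x <= 0.
Proof.
move=> xmax; apply: sumr_le0 => i _.
have [e e0 eP] := near_line x (delta_mx 0 i) _ xmax.
have [|_] := second_derivative_max _ _ _ e e0 (fun s _ => partial_is_derive x i s)
    (partial2_is_derive x i 0).
  by move=> s se; rewrite scale0r addr0; exact: eP.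
by rewrite scale0r addr0.
Qed.

Lemma continuous_sqnB x : continuous (fun y : 'rV[R]_D => sqn (y - x)).
Proof.
apply: (continuous_compose _ _ _ (fun y : 'rV[R]_D => y - x) sqn); last exact:
    continuous_sqn.
apply: (continuous_add _ _ id (fun=> - x)); first by move=> ?; exact: cvg_id.
exact: continuous_cst.
Qed.

Lemma closed_ball_compact x (r : R) : compact [set y : 'rV[R]_D | sqn (y - x) <= r ^+ 2].
Proof.
apply: bounded_closed_compact.
  exists (`|x| + `|r|); split; first by rewrite num_real.
  move=> M xM y /= yr.
  apply: le_trans (ltW xM); rewrite -[y](subrK x) addrC.
  apply: (le_trans (ler_normD _ _)); rewrite lerD2l.
  apply: rV_norm_le => // i; rewrite -ler_sqr ?nnegrE// !real_normK ?num_real//.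
  apply: le_trans yr; rewrite /sqn (bigD1 i)//= lerDl.
  by apply: sumr_ge0 => j _; exact: sqr_ge0.
apply: (@closed_comp _ _ (fun y : 'rV[R]_D => sqn (y - x)) [set t | t <= r ^+ 2]).
  by move=> y _; exact: continuous_sqnB.
exact: closed_le.
Qed.

Variables (f : R -> R) (a v : R).
Hypothesis f_C1 : C1_half_line f.
Hypothesis f_gt0 : forall t, 0 < t -> 0 < f t.
Hypotheses (a0 : 0 < a) (v0 : 0 < v) (Phi_neq0 : Phi a f v != 0).
Hypothesis f_nd : forall s t, v <= s -> s <= t -> f s <= f t.

(** Instead of constructing a blow-up supersolution, [u] is transported to the
    time scale of the one-dimensional problem. With [Q = travel_time v] and
    [k = b / (D + 1)], if the bound failed then [h = Q(u)^2 - k |x - x0|^2],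
    positive at [x0], would be negative on the sphere of radius [r] because
    [Q <= Phi]. At an interior maximum of [h] the first and second order
    conditions give [Delta u <= (D + 1/2) k f(u)], against
    [Delta u >= b f(u)]. Squaring [Q] removes its infinite slope at [v], just as
    the squared distance is smooth at the centre. *)
Lemma keller_osserman_bound x0 (b r : R) : 0 < b -> v < u x0 ->
  (forall x, sqn (x - x0) <= r ^+ 2 -> b * f (u x) <= laplacian u x) ->
  b * r ^+ 2 <= D.+1%:R * Phi a f v ^+ 2.
Proof.
move=> b0 vu0 ub; rewrite leNgt; apply/negP => PhiR.
pose k := b / D.+1%:R.
have k0 : 0 < k by rewrite divr_gt0.
have kb : k * D.+1%:R = b by rewrite /k divfK.
have {}PhiR : Phi a f v ^+ 2 < k * r ^+ 2.
  by rewrite -(@ltr_pM2l _ D.+1%:R)// [ltRHS]mulrA [D.+1%:R * k]mulrC kb.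
pose Q := travel_time f v; pose g := speed_inv f v.
pose h x := Q (u x) ^+ 2 - k * sqn (x - x0).
(* Q is differentiable only beyond v, so the maximum is sought on {u >= w} *)
pose w := (v + u x0) / 2.
have vw : v < w by rewrite /w; lra.
have wu0 : w < u x0 by rewrite /w; lra.
have uc := C2_continuous u uC2.
have Qd y : v < y -> is_derive y 1 Q (g y) by exact: (travel_time_derive f f_C1 f_gt0 a
    v a0 v0 Phi_neq0).
have gd y : v < y -> is_derive y 1 g (- (f y * g y ^+ 3 / 2)).
  exact: (speed_inv_derive f f_C1 f_gt0 v y v0).
have sqnc := continuous_sqnB x0.
pose K := [set x | sqn (x - x0) <= r ^+ 2] `&` [set x | w <= u x].
have Kc : compact K.
  apply: compact_closedI; first exact: closed_ball_compact.
  apply: (@closed_comp _ _ u [set t | w <= t]); last exact: closed_ge.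
  by move=> y _; exact: uc.
have K0 : K x0.
  by split; [rewrite /= subrr /sqn big1 ?sqr_ge0// => i _; rewrite mxE expr0n|exact: ltW].
have hc : {within K, continuous h}.
  apply: continuous_in_subspaceT => x; rewrite inE => -[_ /= wux].
  have vux : v < u x by exact: lt_le_trans wux.
  have Qc : {for x, continuous (fun x => Q (u x))}.
    apply: continuous_comp; first exact: uc.
    apply: differentiable_continuous; apply/derivable1_diffP.
    by have [] := Qd (u x) vux.
  have hE : h = (fun x => Q (u x) * Q (u x) - k * sqn (x - x0)).
    by apply/funext => y; rewrite /h expr2.
  rewrite hE; apply: (cvgB (cvgM Qc Qc)); apply: cvgM; last exact: sqnc.
  exact: cvg_cst.
have [x1 x1K x1max] := compact_EVT_max (ex_intro _ x0 K0) Kc hc.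
have hx1 : h x0 <= h x1 by apply: x1max; rewrite inE.
rewrite inE in x1K; case: x1K => /= x1r wu1.
have sqn0 : sqn (x0 - x0) = 0.
  by rewrite subrr /sqn big1// => i _; rewrite mxE expr0n.
have Q0 y : v < y -> 0 < Q y by exact: (travel_time_gt0 f f_C1 f_gt0 a v a0 v0 Phi_neq0).
have vu1 : v < u x1 by exact: lt_le_trans wu1.
have hpos : k * sqn (x1 - x0) < Q (u x1) ^+ 2.
  rewrite -subr_gt0; apply: lt_le_trans hx1.
  by rewrite /h sqn0 mulr0 subr0 exprn_gt0// Q0.
have x1in : sqn (x1 - x0) < r ^+ 2.
  rewrite -(@ltr_pM2l _ k)//; apply: lt_trans hpos _; apply: le_lt_trans PhiR.
  have hq := travel_time_le_Phi _ f_C1 f_gt0 a v a0 v0 Phi_neq0 _ vu1.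
  by rewrite ler_sqr ?nnegrE// ?(le_trans _ hq)// ltW// Q0.
have {}wu1 : w < u x1.
  rewrite lt_neqAle wu1 andbT; apply/negP => /eqP wE.
  have : Q w < Q (u x0) by apply: (travel_time_increasing f f_C1 f_gt0 a v a0 v0 Phi_neq0).
  move: hx1; rewrite /h sqn0 mulr0 subr0 -wE.
  have := sqn_ge0 (x1 - x0); have := Q0 _ vw; nra.
have nearK : \forall y \near x1, sqn (y - x0) < r ^+ 2 /\ w < u y.
  near=> y; split; near: y.
    by have /cvgr_lt := sqnc x1; apply.
  by have /cvgr_gt := uc x1; apply.
pose p i := partial i u x1.
pose pp i := partial i (partial i u) x1.
pose q := Q (u x1); pose g1 := g (u x1).
have key i : q * g1 * p i = k * (x1 - x0) 0 i /\
   2 * g1 ^+ 2 * p i ^+ 2 - q * (f (u x1) * g1 ^+ 3) * p i ^+ 2 + 2 * q * g1 * pp i - 2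
       * k <= 0.
  have [e e0 eP] := near_line x1 (delta_mx 0 i) _ nearK.
  pose U s := u (x1 + s *: delta_mx 0 i).
  have Ud (s : R) : is_derive s 1 U (partial i u (x1 + s *: delta_mx 0 i)).
    exact: partial_is_derive.
  pose dh s := 2 * (Q (U s) * g (U s) * partial i u (x1 + s *: delta_mx 0 i)) -
     2 * k * (x1 + s *: delta_mx 0 i - x0) 0 i.
  pose m := 2 * ((g1 * p i * g1 + q * (- (f (u x1) * g1 ^+ 3 / 2) * p i)) * p i + q *
      g1 * pp i) - 2 * k.
  have := second_derivative_max (fun s => h (x1 + s *: delta_mx 0 i)) dh m e e0.
  case.
  - move=> s se; have [_ wU] := eP s se; have vU : v < U s by exact: lt_trans wU.
    have dQ : is_derive s 1 (fun s => Q (U s)) (g (U s) * partial i u (x1 + s *: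
        delta_mx 0 i)).
      exact: (is_derive1_comp (Qd _ vU) (Ud s)).
    have dS : is_derive s 1 (fun s => sqn ((x1 - x0) + s *: delta_mx 0 i))
        (2 * (x1 - x0 + s *: delta_mx 0 i) 0 i).
      by apply: is_derive_line; exact: is_derive_sqn.
    have dS2 := is_deriveZ (- k) dS.
    have dQ2 := is_derive_mul _ _ _ _ _ _ _ dQ dQ.
    have dH := is_derive_add _ _ _ _ _ _ _ dQ2 dS2.
    have -> : (fun s => h (x1 + s *: delta_mx 0 i)) = (fun s => Q (U s) * Q (U s) +
        (- k \*: (fun s => sqn ((x1 - x0) + s *: delta_mx 0 i))) s).
      by apply/funext => s'; rewrite /h /= /GRing.scale /= mulNr expr2 [x1 - x0 + _]addrAC.
    apply: (is_derive_eq dH); rewrite /dh [x1 - x0 + _]addrAC /GRing.scale /=.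
    by ring.
  - have U0 : U 0 = u x1 by rewrite /U scale0r addr0.
    have vU : v < U 0 by rewrite U0.
    have dQ : is_derive (0 : R) 1 (fun s => Q (U s)) (g (U 0) * partial i u (x1 + (0 :
        R) *: delta_mx 0 i)).
      exact: (is_derive1_comp (Qd _ vU) (Ud 0)).
    have dg : is_derive (0 : R) 1 (fun s => g (U s)) (- (f (U 0) * g (U 0) ^+ 3 / 2) *
        partial i u (x1 + (0 : R) *: delta_mx 0 i)).
      exact: (is_derive1_comp (gd _ vU) (Ud 0)).
    have dp := partial2_is_derive x1 i 0.
    have dL : is_derive (0 : R) 1 (fun s : R => (x1 - x0 + s *: delta_mx 0 i) 0 i) 1.
      have := @is_derive_line R D (fun z => z 0 i) (x1 - x0) (delta_mx 0 i) 0 1; apply.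
      by apply: (is_derive_eq (is_derive_coord _ _ _)); rewrite eqxx.
    have dL2 := is_deriveZ (- (2 * k)) dL.
    have dM := is_deriveZ 2 (is_derive_mul _ _ _ _ _ _ _ (is_derive_mul _ _ _ _ _ _ _
        dQ dg) dp).
    have dH := is_derive_add _ _ _ _ _ _ _ dM dL2.
    have -> : dh = (fun s : R => (2 \*: (fun s => Q (U s) * g (U s) * partial i u (x1 +
        s *: delta_mx 0 i))) s +
      (- (2 * k) \*: (fun s : R => (x1 - x0 + s *: delta_mx 0 i) 0 i)) s).
      by apply/funext => s'; rewrite /dh /= /GRing.scale /= mulNr [x1 - x0 + _]addrAC.
    apply: (is_derive_eq dH); rewrite /m U0 -/q -/g1 scale0r addr0 -/(p i) -/(pp i)
        /GRing.scale /=.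
    by ring.
  - move=> s se; have [sr wU] := eP s se; rewrite scale0r addr0.
    by apply: x1max; rewrite inE; split; rewrite /= ltW.
  rewrite /dh /U scale0r addr0 -/q -/g1 -/(p i) => h1 h2; split.
    by move: ((x1 - x0) 0 i) h1 => z; lra.
  by apply: le_trans h2; rewrite /m le_eqVlt; apply/orP; left; apply/eqP; field.
have g10 : 0 < g1 by exact: (speed_inv_gt0 f f_C1 f_gt0 v (u x1) v0 vu1).
have q0 : 0 < q by exact: Q0.
have f0 : 0 < f (u x1) by apply: f_gt0; exact: lt_trans vu1.
have qfg : 1 <= q * f (u x1) * g1 by exact: (travel_time_force_ge1 f f_C1 f_gt0 a v a0
    v0 Phi_neq0 f_nd (u x1) vu1).
pose S := \sum_i p i ^+ 2.
have S0 : 0 <= S by apply: sumr_ge0 => i _; exact: sqr_ge0.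
have SE : q ^+ 2 * g1 ^+ 2 * S = k ^+ 2 * sqn (x1 - x0).
  rewrite /S /sqn !mulr_sumr; apply: eq_bigr => i _.
  by rewrite -!exprMn; have [-> _] := key i.
have lapE : 2 * g1 ^+ 2 * S - q * (f (u x1) * g1 ^+ 3) * S + 2 * q * g1 * laplacian u
    x1 - D%:R * (2 * k) <= 0.
  have : \sum_(i < D) (2 * g1 ^+ 2 * p i ^+ 2 - q * (f (u x1) * g1 ^+ 3) * p i ^+ 2 + 2
      * q * g1 * pp i - 2 * k) <= 0.
    by apply: sumr_le0 => i _; have [_] := key i.
  rewrite !big_split /= !sumrN sumr_const card_ord -!mulr_sumr.
  by rewrite -[X in _ - X <= 0 -> _]mulr_natl.
(* from the first order condition and k |x1 - x0|^2 < q^2 *)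
have gS : g1 ^+ 2 * S <= k.
  rewrite -(@ler_pM2l _ (q ^+ 2)) ?exprn_gt0// mulrA SE expr2 -mulrA [leRHS]mulrC.
  by rewrite ler_wpM2l// ltW.
have lap1 : b * f (u x1) <= laplacian u x1 by exact: ub.
have D0 : 0 <= D%:R :> R by [].
have kD : k * (D%:R + 1) = b by rewrite natr1.
have A1 : 2 * q * g1 * (b * f (u x1)) <= 2 * q * g1 * laplacian u x1.
  by rewrite ler_wpM2l// !mulr_ge0// ltW.
have A2 : q * f (u x1) * g1 * (g1 ^+ 2 * S) <= q * f (u x1) * g1 * k.
  by rewrite ler_wpM2l// !mulr_ge0// ltW.
have A3 : 0 <= g1 ^+ 2 * S by rewrite mulr_ge0// sqr_ge0.
have A4 : D%:R * (2 * k) * 1 <= D%:R * (2 * k) * (q * f (u x1) * g1).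
  by rewrite ler_wpM2l// mulr_ge0// mulr_ge0// ltW.
have A5 : k * 1 <= k * (q * f (u x1) * g1) by rewrite ler_wpM2l// ltW.
have A6 : 2 * q * g1 * (b * f (u x1)) = 2 * D%:R * k * (q * f (u x1) * g1) + 2 * k * (q
    * f (u x1) * g1).
  by rewrite -kD; ring.
have A7 : q * (f (u x1) * g1 ^+ 3) * S = q * f (u x1) * g1 * (g1 ^+ 2 * S) by ring.
move: lapE A1 A2 A3 A4 A5 A6; rewrite A7.
set X := q * f (u x1) * g1; set Y := g1 ^+ 2 * S; nra.
Unshelve. all: by end_near.
Qed.
End C2_max.
End maximum.

(** * From local to global on large spheres *)

Section spheres.
Context {R : realType} {D : nat}.
Implicit Types (p q z x y : 'rV[R]_D).

Definition dot p q : R := \sum_i p 0 i * q 0 i.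

Lemma dot_sym p q : dot p q = dot q p.
Proof. by apply: eq_bigr => i _; rewrite mulrC. Qed.

Lemma dot_sqn p : dot p p = sqn p.
Proof. by apply: eq_bigr => i _; rewrite expr2. Qed.

Lemma sqnD p q : sqn (p + q) = sqn p + 2 * dot p q + sqn q.
Proof.
rewrite /sqn /dot mulr_sumr -!big_split /=; apply: eq_bigr => i _.
by rewrite mxE; ring.
Qed.

Lemma sqnB p q : sqn (p - q) = sqn p - 2 * dot p q + sqn q.
Proof.
have -> : sqn (p - q) = sqn (p + -1 *: q) by rewrite scaleN1r.
rewrite sqnD sqnZ; have -> : dot p (-1 *: q) = - dot p q.
  by rewrite /dot -sumrN; apply: eq_bigr => i _; rewrite mxE mulN1r mulrN.
by ring.
Qed.

(** Together with [sqn_near]: if [|y - x| <= |x|/2] then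
    [|x|/2 <= |y| <= 3|x|/2], in a form that needs no square roots. *)
Lemma sqn_far x y : sqn x / 2 - sqn (y - x) <= sqn y.
Proof.
have -> : sqn y = sqn x + 2 * dot x (y - x) + sqn (y - x).
  by rewrite -sqnD addrC subrK.
have := sqn_ge0 (x + 2 *: (y - x)); rewrite (sqnD x) sqnZ.
have -> : dot x (2 *: (y - x)) = 2 * dot x (y - x).
  by rewrite /dot mulr_sumr; apply: eq_bigr => i _; rewrite mxE mulrCA.
lra.
Qed.

Lemma sqn_near x y : sqn y <= 3 / 2 * sqn x + 3 * sqn (y - x).
Proof.
have -> : sqn y = sqn x + 2 * dot x (y - x) + sqn (y - x).
  by rewrite -sqnD addrC subrK.
have := sqn_ge0 (x - 2 *: (y - x)); rewrite (sqnB x) sqnZ.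
have -> : dot x (2 *: (y - x)) = 2 * dot x (y - x).
  by rewrite /dot mulr_sumr; apply: eq_bigr => i _; rewrite mxE mulrCA.
lra.
Qed.

Lemma enormE x : enorm x = Num.sqrt (sqn x).
Proof. by []. Qed.

Lemma enorm_sqr x : enorm x ^+ 2 = sqn x.
Proof. by rewrite enormE sqr_sqrtr// sqn_ge0. Qed.

Section chain.
Variables (u : 'rV[R]_D -> R) (H : R).
Hypothesis H0 : 0 <= H.
Hypothesis local_harnack : forall x y, 16 < sqn x ->
  sqn (x - y) <= sqn x / 256 -> u y <= H * u x.

(** When the angle between [p] and [q] is not obtuse, the segment stays at
    distance at least [r / sqrt 2] from the origin; 32 steps of length at most
    [sqrt 2 r / 32] each stay within one sixteenth of that distance. *)
Lemma harnack_segment p q (r : R) : 64 < r ^+ 2 -> sqn p = r ^+ 2 ->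
  sqn q = r ^+ 2 -> 0 <= dot p q -> u p <= H ^+ 32 * u q.
Proof.
move=> r64 pr qr pq.
pose z j : 'rV[R]_D := p + (j%:R / 32) *: (q - p).
have zfar j : (j <= 32)%N -> r ^+ 2 / 2 <= sqn (z j).
  move=> j32; rewrite /z; set t := j%:R / 32.
  have t0 : 0 <= t by rewrite divr_ge0.
  have t1 : t <= 1 by rewrite ler_pdivrMr// mul1r ler_nat.
  have -> : p + t *: (q - p) = (1 - t) *: p + t *: q.
    by rewrite scalerBr scalerBl scale1r addrA addrAC.
  rewrite sqnD !sqnZ pr qr.
  have -> : dot ((1 - t) *: p) (t *: q) = (1 - t) * t * dot p q.
    by rewrite /dot mulr_sumr; apply: eq_bigr => i _; rewrite !mxE; ring.
  have : 0 <= (1 - t) * t * dot p q by rewrite !mulr_ge0// subr_ge0.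
  have : 0 <= (2 * t - 1) ^+ 2 * r ^+ 2 by rewrite mulr_ge0// sqr_ge0.
  by move: (dot p q) (r ^+ 2) => a b; nra.
have step j : (j <= 32)%N -> u p <= H ^+ j * u (z j).
  elim: j => [_|j IH j32]; first by rewrite /z mul0r scale0r addr0 expr0 mul1r.
  apply: (le_trans (IH (ltnW j32))); rewrite exprSr -mulrA ler_wpM2l ?exprn_ge0//.
  have far := zfar j.+1 j32; apply: local_harnack; first lra.
  have -> : z j.+1 - z j = 32^-1 *: (q - p).
    by rewrite /z opprD addrACA subrr add0r -scalerBl -mulrBl -natrB// subSnn mul1r.
  by rewrite sqnZ sqnB pr qr dot_sym; lra.
have <- : z 32 = q by rewrite /z divff ?pnatr_eq0// scale1r addrC subrK.
exact: step.
Qed.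

(** Every point of the sphere is joined to [r e_0] through an intermediate point,
    the point itself or [+- r e_1], with no obtuse angle on the way. *)
Lemma harnack_sphere p q (r : R) : (2 <= D)%N -> 64 < r ^+ 2 ->
  sqn p = r ^+ 2 -> sqn q = r ^+ 2 -> u p <= H ^+ 128 * u q.
Proof.
move=> D2 r64 pr qr.
pose i0 : 'I_D := Ordinal (ltnW D2); pose i1 : 'I_D := Ordinal D2.
pose e (i : 'I_D) (s : R) : 'rV[R]_D := s *: delta_mx 0 i.
have ds x i s : dot x (e i s) = s * x 0 i.
  rewrite /dot (bigD1 i)//= big1 ?addr0; first by rewrite !mxE !eqxx mulr1 mulrC.
  by move=> j /negbTE ji; rewrite !mxE ji andbF !mulr0.
have sqe i s : sqn (e i s) = s ^+ 2.
  by rewrite -dot_sqn ds !mxE !eqxx mulr1 expr2.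
have mid x : sqn x = r ^+ 2 -> exists z, [/\ sqn z = r ^+ 2, 0 <= dot x z & 0 <= dot z
    (e i0 `|r|)].
  move=> xr; have [x0|x0] := leP 0 (x 0 i0).
    exists x; split=> //; first by rewrite dot_sqn sqn_ge0.
    by rewrite ds mulr_ge0.
  have h s : dot (e i1 s) (e i0 `|r|) = 0 by rewrite ds !mxE /= mulr0 mulr0.
  have [y0|y0] := leP 0 (x 0 i1).
    by exists (e i1 `|r|); rewrite h sqe real_normK ?num_real// ds mulr_ge0.
  exists (e i1 (- `|r|)); rewrite h sqe sqrrN real_normK ?num_real//; split=> //.
  by rewrite ds mulNr -mulrN mulr_ge0// oppr_ge0 ltW.
have er : sqn (e i0 `|r|) = r ^+ 2 by rewrite sqe real_normK ?num_real.
have [z [zr pz ze]] := mid p pr; have [w [wr qw we]] := mid q qr.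
have HE : H ^+ 128 = H ^+ 32 * (H ^+ 32 * (H ^+ 32 * H ^+ 32)) by rewrite -!exprD.
have HH : 0 <= H ^+ 32 by rewrite exprn_ge0.
have seg x y : sqn x = r ^+ 2 -> sqn y = r ^+ 2 -> 0 <= dot x y ->
    u x <= H ^+ 32 * u y by move=> xr yr; exact: (harnack_segment x y r).
rewrite HE; move: (H ^+ 32) HH seg => h h0 seg; rewrite -!mulrA.
apply: le_trans (seg p z pr zr pz) _; rewrite ler_wpM2l//.
apply: le_trans (seg z _ zr er ze) _; rewrite ler_wpM2l//.
rewrite dot_sym in we; apply: le_trans (seg _ w er wr we) _; rewrite ler_wpM2l//.
by rewrite dot_sym in qw; exact: seg.
Qed.
End chain.
End spheres.

(** * The scale-invariant differential inequality *)

Section growth.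
Context {R : realType} {D : nat}.
Variables (a : R) (f : R -> R) (rho u : 'rV[R]_D -> R).
Hypotheses (a0 : 0 < a) (f_C1 : C1_half_line f) (f0 : f 0 = 0)
  (f_gt0 : forall t, 0 < t -> 0 < f t) (rho_gt0 : forall x, 0 < rho x)
  (u_C2 : C2 u) (u_gt0 : forall x, 0 < u x)
  (u_eq : forall x, laplacian u x = rho x * f (u x)).
Variables (c alpha M C : R).
Hypotheses (c0 : 0 < c) (alpha2 : 2 < alpha)
  (rho_decay : forall x, 1 < enorm x ->
     c * enorm x `^ (- alpha) <= rho x <= c^-1 * enorm x `^ (- alpha)).
Hypotheses (M0 : 0 < M)
  (f_ratio : forall s t, M <= s -> s <= t -> f s / s <= f t / t)
  (C0 : 0 < C) (f_Phi : forall s, M <= s -> f s / s <= C / Phi a f s ^+ 2).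

Lemma nondecreasing_of_ratio s t : M <= s -> s <= t -> f s <= f t.
Proof.
move=> Ms st; have s0 : 0 < s by exact: lt_le_trans Ms.
have t0 : 0 < t by exact: lt_le_trans st.
have := f_ratio s t Ms st; rewrite ler_pdivrMr// => /le_trans; apply.
by rewrite mulrAC ler_pdivrMr// ler_wpM2l// ltW// f_gt0.
Qed.

(** Division by zero yields zero, so [Phi a f s = 0] would contradict the upper
    bound on [f s / s]. *)
Lemma Phi_neq0 s : M <= s -> Phi a f s != 0.
Proof.
move=> Ms; have s0 : 0 < s by exact: lt_le_trans Ms.
apply/eqP => P0; have := f_Phi s Ms.
by rewrite P0 expr0n /= invr0 mulr0 leNgt divr_gt0// f_gt0.
Qed.

Lemma powR_decay (n m : R) : 0 < n -> n <= m -> m `^ (- alpha) <= n `^ (- alpha).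
Proof.
move=> n0 nm; have m0 : 0 < m by exact: lt_le_trans nm.
rewrite !powRN lef_pV2 ?posrE ?powR_gt0//.
have al0 : 0 <= alpha by apply/ltW/(lt_trans _ alpha2).
by apply: ge0_ler_powR => //; rewrite nnegrE ltW.
Qed.

(** [keller_osserman_bound] applies at every level [M <= v < u x], on the ball of
    radius [|x|/2], where [rho] is at least [c (3|x|/2)^(-alpha)]; the level
    [u x] itself is reached by continuity of [f]. *)
Lemma large_value_bound x : 4 < sqn x -> M < u x ->
  f (u x) * (c * (3 / 2 * enorm x) `^ (- alpha)) * sqn x <= 4 * D.+1%:R * C * u x.
Proof.
move=> x4 Mu.
set n := enorm x; set b := c * _.
have n2 : n ^+ 2 = sqn x by exact: enorm_sqr.
have n0 : 0 <= n by exact: sqrtr_ge0.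
have n_gt0 : 0 < n by rewrite /n enormE sqrtr_gt0; lra.
have b0 : 0 < b by rewrite mulr_gt0// powR_gt0// mulr_gt0.
have ub y : sqn (y - x) <= (n / 2) ^+ 2 -> b * f (u y) <= laplacian u y.
  rewrite expr_div_n n2 => yx.
  have := sqn_far x y; have := sqn_near x y => h1 h2.
  have y1 : 1 < enorm y by rewrite enormE -sqrtr1 ltr_sqrt//; lra.
  have yn : enorm y <= 3 / 2 * n.
    rewrite -ler_sqr ?nnegrE ?sqrtr_ge0//; last by lra.
    by rewrite enorm_sqr exprMn n2; lra.
  have /andP[h3 _] := rho_decay y y1.
  rewrite u_eq ler_wpM2r//; first by rewrite ltW// f_gt0.
  apply: le_trans h3; rewrite ler_wpM2l ?(ltW c0)//; apply: powR_decay => //.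
  by apply: lt_trans y1.
have fv v : M <= v -> v < u x -> f v * b * sqn x <= 4 * D.+1%:R * C * u x.
  move=> Mv vu; have v0 : 0 < v by exact: lt_le_trans Mv.
  have nd s t : v <= s -> s <= t -> f s <= f t.
    by move=> vs; apply: nondecreasing_of_ratio; exact: le_trans vs.
  have P0 := Phi_neq0 v Mv.
  have := keller_osserman_bound u u_C2 f a v f_C1 f_gt0 a0 v0 P0 nd x b (n / 2) b0 vu ub.
  rewrite expr_div_n n2 => h.
  have P2 : 0 < Phi a f v ^+ 2 by rewrite exprn_even_gt0.
  have := f_Phi v Mv; rewrite ler_pdivrMr// mulrAC ler_pdivlMr// => hP.
  have fv0 : 0 < f v by exact: f_gt0.
  have D0 : 0 < D.+1%:R :> R by [].
  have h1 : f v * (b * (sqn x / 2 ^+ 2)) <= f v * (D.+1%:R * Phi a f v ^+ 2).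
    by rewrite ler_wpM2l// ltW.
  have h2 : D.+1%:R * (f v * Phi a f v ^+ 2) <= D.+1%:R * (C * v) by rewrite ler_wpM2l.
  have h3 : D.+1%:R * (C * v) <= D.+1%:R * (C * u x).
    by rewrite ler_wpM2l// ler_wpM2l ?ltW.
  move: h1 h2 h3; move: (Phi a f v ^+ 2) (D.+1%:R) => P d h1 h2 h3; lra.
have fl : f v * b * sqn x @[v --> (u x)^'-] --> f (u x) * b * sqn x.
  have fc : f v @[v --> (u x)^'-] --> f (u x).
    apply: cvg_at_left_filter; exact: (C1_half_line_continuous f f_C1).
  by apply: cvgM; [apply: cvgM => //|]; exact: cvg_cst.
apply: (cvgr_to_le fl); near=> v; apply: fv; near: v.
- exact: nbhs_left_ge.
- exact: nbhs_left_lt.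
Unshelve. all: by end_near.
Qed.

Lemma scale_invariant_bound : exists2 K : R, 0 <= K &
  forall x, 4 < sqn x -> laplacian u x * sqn x <= K * u x.
Proof.
have [B B0 fB] := C1_half_line_ratio_bounded f f_C1 M f0.
pose A := c * (3 / 2) `^ (- alpha).
have A0 : 0 < A by rewrite mulr_gt0// powR_gt0.
exists (c^-1 * B + c^-1 * A^-1 * (4 * D.+1%:R * C)).
  by rewrite addr_ge0// !mulr_ge0// ?invr_ge0 ltW.
move=> x x4.
have n2 := enorm_sqr x; set n := enorm x in n2 *.
have n0 : 0 <= n by exact: sqrtr_ge0.
have n1 : 1 < n by rewrite /n enormE -sqrtr1 ltr_sqrt//; lra.
have /andP[_ h3] := rho_decay x n1; rewrite -/n in h3.
have fu := f_gt0 _ (u_gt0 x).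
have s0 := sqn_ge0 x.
rewrite u_eq mulrDl.
have lb : rho x * f (u x) * sqn x <= c^-1 * n `^ (- alpha) * f (u x) * sqn x.
  by rewrite ler_wpM2r// ler_wpM2r// ltW.
apply: (le_trans lb).
have [uM|Mu] := leP (u x) M.
  apply: ler_wpDr; first by rewrite !mulr_ge0// ?invr_ge0 ltW.
  rewrite -!mulrA ler_wpM2l ?invr_ge0 ?(ltW c0)// mulrCA.
  have h1 : n `^ (- alpha) * sqn x <= 1.
    rewrite powRN -n2 mulrC ler_pdivrMr ?powR_gt0 ?(lt_trans ltr01)// mul1r.
    by rewrite -powR_mulrn//; apply: ler_powR; rewrite ltW.
  apply: (@le_trans _ _ (f (u x) * 1)); first by rewrite ler_wpM2l// ltW.
  by rewrite mulr1; exact: fB.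
apply: ler_wpDl; first by rewrite !mulr_ge0// ?invr_ge0 ltW.
have := large_value_bound x x4 Mu; rewrite -/n powRM//.
move=> h; rewrite -!mulrA ler_wpM2l ?invr_ge0 ?(ltW c0)//.
rewrite ler_pdivlMl//; move: h; rewrite /A; lra.
Qed.

Lemma laplacian_gt0 x : 0 < laplacian u x.
Proof. by rewrite u_eq mulr_gt0// f_gt0. Qed.

(** The ball of radius [3|x|/16] around [x] stays at distance at least [|x|/2]
    from the origin, so [k (3 l)^2] is independent of [x] in [harnack]. *)
Lemma local_harnack : exists2 H : R, 0 < H & forall x y, 16 < sqn x ->
  sqn (x - y) <= sqn x / 256 -> u y <= H * u x.
Proof.
have [K K0 lapK] := scale_invariant_bound.
have [L HL] := @cube_mean_exists R D.
exists (expR (4 + 2 * D%:R + K)); first exact: expR_gt0.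
move=> x y x16 xy.
have s0 : 0 < sqn x by lra.
pose l := enorm x / 16; pose k := 4 * K / sqn x.
have l0 : 0 < l by rewrite divr_gt0// sqrtr_gt0.
have l2 : l ^+ 2 = sqn x / 256 by rewrite expr_div_n enorm_sqr; congr (_ / _); ring.
have k0 : 0 <= k by rewrite divr_ge0 ?mulr_ge0// ltW.
have lapk x' : sqn (x' - x) <= (3 * l) ^+ 2 -> laplacian u x' <= k * u x'.
  rewrite exprMn l2 => x'x; have := sqn_far x x' => h.
  have h4 : sqn x / 4 <= sqn x' by lra.
  have := lapK x' ltac:(lra) => h5.
  rewrite /k mulrAC ler_pdivlMr//; have := laplacian_gt0 x'; nra.
apply: le_trans (harnack L HL u u_C2 (fun x => ltW (u_gt0 x))
  (fun x => ltW (laplacian_gt0 x)) x y l k l0 k0 _ lapk) _.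
  by rewrite l2.
rewrite ler_wpM2r ?(ltW (u_gt0 x))// ler_expR lerD2l exprMn l2 /k.
rewrite (_ : _ * _ = 36 / 256 * K); last by field; rewrite gt_eqF.
lra.
Qed.
End growth.

(** * Growth at infinity *)

Theorem theorem2p7 (R : realType) (D : nat) (a : R) (f : R -> R)
    (rho u : 'rV[R]_D -> R)
    (hD : (3 <= D)%N)
    (ha : 0 < a)
    (f_C1 : C1_half_line f)
    (f_neq0 : exists2 t, 0 <= t & f t != 0)
    (f0 : f 0 = 0)
    (f_gt0 : forall t, 0 < t -> 0 < f t)
    (f_KO : keller_osserman a f)
    (rho_C1 : C1 rho)
    (rho_gt0 : forall x, 0 < rho x)
    (rho_potential : newton_potential rho x @[x --> at_infinity] --> 0%E)
    (rho_decay : exists c alpha : R, [/\ 0 < c, c < 1, 2 < alpha &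
       forall x, 1 < enorm x ->
         c * enorm x `^ (- alpha) <= rho x <= c^-1 * enorm x `^ (- alpha)])
    (f_growth : exists M : R, [/\ 0 < M,
       forall s t, M <= s -> s <= t -> f s / s <= f t / t &
       exists2 C : R, 0 < C &
         forall s, M <= s -> f s / s <= C / Phi a f s ^+ 2])
    (u_C2 : C2 u)
    (u_gt0 : forall x, 0 < u x)
    (u_eq : forall x, laplacian u x = rho x * f (u x))
    (u_unbounded : ~ bounded_fun u) :
  u x @[x --> at_infinity] --> +oo.
Proof.
have [c [alpha [c0 _ alpha2 rho_bd]]] := rho_decay.
have [M [M0 f_ratio [C C0 f_Phi]]] := f_growth.
have [H H0 Har] := local_harnack a f rho u ha f_C1 f0 f_gt0 rho_gt0 u_C2 u_gt0 u_eq
  c alpha M C c0 alpha2 rho_bd M0 f_ratio C0 f_Phi.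
have u_large A : exists x, A < u x.
  apply: contrapT => /forallNP uA; apply: u_unbounded.
  exists A; split; first by rewrite num_real.
  move=> B AB x _ /=; rewrite gtr0_norm//; apply: le_trans (ltW AB).
  by rewrite leNgt; apply/negP; exact: uA.
apply/cvgryPgt => A.
have [x0 x0A] := u_large (A * H ^+ 128).
(* r > 8 keeps the chains, whose points satisfy |z|^2 >= r^2 / 2, where local_harnack holds *)
exists (Num.max 8 (enorm x0)) => // y /=; rewrite gt_max => /andP[y8 yx0].
set r := enorm y in y8 yx0.
have r0 : 0 < r by exact: lt_trans y8.
have yr : sqn y = r ^+ 2 by rewrite enorm_sqr.
have r64 : 64 < r ^+ 2.
  by rewrite (_ : 64 = 8 ^+ 2) ?ltr_sqr ?nnegrE ?ltW//; ring.
pose K := [set z : 'rV[R]_D | sqn (z - 0) <= r ^+ 2].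
have Kx0 : K x0.
  by rewrite /K /= subr0 -enorm_sqr ler_sqr ?nnegrE ?sqrtr_ge0 ?ltW.
have uc := C2_continuous u u_C2.
have [p pK pmax] := compact_EVT_max (ex_intro _ x0 Kx0) (closed_ball_compact 0 r)
  (continuous_subspaceT uc).
have px0 : u x0 <= u p by apply: pmax; rewrite inE.
rewrite inE /= subr0 in pK.
have pr : sqn p = r ^+ 2.
  apply/eqP; rewrite eq_le pK /= leNgt; apply/negP => pin.
  have : laplacian u p <= 0.
    apply: laplacian_max => //.
    have /cvgr_lt /(_ _ pin) := @continuous_sqn R D p.
    by apply: filterS => z zr; apply: pmax; rewrite inE /= subr0 ltW.
  by rewrite leNgt u_eq mulr_gt0// f_gt0.
have py := harnack_sphere u H (ltW H0) Har p y r (ltnW hD) r64 pr yr.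
rewrite -(@ltr_pM2r _ (H ^+ 128)) ?exprn_gt0// [ltRHS]mulrC.
exact: lt_le_trans (lt_le_trans x0A px0) py.
Qed.
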